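(* Let $p$ be any prime, $\mathbb{F}$ a field of characteristic $p$, and $n$ any positive integer. Let $H_k^{/a}$, $H_k^{\backslash a}$, $H_k^{/}$, $H_k^{\backslash}$ denote the slash and backslash homologies of the $p$-complex $\mathbb{F}\Omega_\bullet$ of $\mathbb{F}\mathfrak{S}_n$-modules (see context), with $k\in\{0,1,\dots,n\}$ and $a\in\{0,1,\dots,p-2\}$. The slash homology $p$-complex $H_k^{/}$ (respectively, the backslash homology $p$-complex $H_{n-k}^{\backslash}$) is non-vanishing if, and only if, $p\neq 2$ and $n-2k\in\{0,1,\dots,p-2\}$. In such a case, we have $$H_k^{/}\cong\big(H_{n-k}^{/n-2k}\xrightarrow{\sim}H_{n-k-1}^{/n-2k-1}\xrightarrow{\sim}\cdots\xrightarrow{\sim}H_{k+1}^{/1}\xrightarrow{\sim}H_k^{/0}\big)$$ $$\cong\big(D^{(n-k,k)}\xrightarrow{\sim}D^{(n-k,k)}\xrightarrow{\sim}\cdots\xrightarrow{\sim}D^{(n-k,k)}\xrightarrow{\sim}D^{(n-k,k)}\big)$$ $$\cong\big(H_{n-k}^{\backslash 0}\xrightarrow{\sim}H_{n-k-1}^{\backslash 1}\xrightarrow{\sim}\cdots\xrightarrow{\sim}H_{k+1}^{\backslash n-2k-1}\xrightarrow{\sim}H_k^{\backslash n-2k}\big)\cong H_{n-k}^{\backslash},$$ where each displayed complex has $n-2k+1$ terms, in degrees $n-k,n-k-1,\dots,k$, and the arrows in the slash (respectively backslash) rows are the maps $\overline{\varphi}^{/}$ (respectively $\overline{\varphi}^{\backslash}$)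 induced by $\varphi$. In particular, the following hold. (1) $H_k^{/a}$ is non-vanishing if, and only if, $p\neq2$ and $a\le n-2(k-a)\le p-2$; in such a case, we have $H_k^{/a}\cong D^{(n-(k-a),\,k-a)}$. (2) $H_k^{\backslash a}$ is non-vanishing if, and only if, $p\neq2$ and $a\le 2(k+a)-n\le p-2$; in such a case, we have $H_k^{\backslash a}\cong D^{(k+a,\,n-(k+a))}$.
   Context: Modules are right modules and maps are written on the right. For $k\in\{0,\dots,n\}$, $\Omega_k$ is the set of $k$-element subsets of $\{1,\dots,n\}$ and $\mathbb{F}\Omega_k$ is the $\mathbb{F}$-vector space with basis $\Omega_k$, with the natural action of the symmetric group $\mathfrak{S}_n$; put $\mathbb{F}\Omega_k=0$ for other $k\in\mathbb{Z}$. The $\mathbb{F}\mathfrak{S}_n$-linear map $\varphi_k:\mathbb{F}\Omega_k\to\mathbb{F}\Omega_{k-1}$ sends $\omega\in\Omega_k$ to $\sum_{\omega'\subset\omega,\ |\omega'|=k-1}\omega'$ (and $\varphi_k=0$ for $k\notin\{1,\dots,n\}$). Then $\varphi^p=0$, where $\varphi^r$ denotes $r$ consecutive applications. A $p$-complex of $A$-modules is a $\mathbb{Z}$-graded $A$-module with a degree $-1$ endomorphism $\partial$ such that $\partial^p=0$; thus $\mathbb{F}\Omega_\bullet=(\bigoplus_k\mathbb{F}\Omega_k,\varphi)$ is a $p$-complex of $\mathbb{F}\mathfrak{S}_n$-modules. We write $\varphi^r_k$ for $\varphi^r$ restricted to $\mathbb{F}\Omega_k$ (mapping to $\mathbb{F}\Omega_{k-r}$).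 For $a\in\{0,\dots,p-2\}$ and $k\in\mathbb{Z}$, define $$H_k^{/a}=\mathrm{Ker}(\varphi_k^{a+1})/\big(\mathrm{Im}(\varphi^{p-a-1}_{k+p-a-1})+\mathrm{Ker}(\varphi_k^{a})\big),\qquad H_k^{\backslash a}=\big(\mathrm{Im}(\varphi^a_{k+a})\cap\mathrm{Ker}(\varphi_k^{p-a-1})\big)/\mathrm{Im}(\varphi^{a+1}_{k+a+1}).$$ The map $\varphi$ induces $\overline{\varphi}^{/}:H_k^{/a}\to H_{k-1}^{/a-1}$ (zero if $a=0$) and $\overline{\varphi}^{\backslash}:H_k^{\backslash a}\to H_{k-1}^{\backslash a+1}$ (zero if $a=p-2$). The slash and backslash homology at degree $k$ are the $p$-complexes $$H_k^{/}=\Big(\bigoplus_{a=0}^{p-2}H_{k+a}^{/a},\ \overline{\varphi}^{/}\Big),\qquad H_k^{\backslash}=\Big(\bigoplus_{a=0}^{p-2}H_{k-a}^{\backslash a},\ \overline{\varphi}^{\backslash}\Big),$$ where $H_{j}^{/a}$ and $H_j^{\backslash a}$ sit in degree $j$. For $0\le 2k\le n$ and $p\ne2$, $D^{(n-k,k)}=S^{(n-k,k)}/\mathrm{rad}\,S^{(n-k,k)}$ is the irreducible $\mathbb{F}\mathfrak{S}_n$-module given by the simple top of the Specht module $S^{(n-k,k)}$. Here $S^{(n-k,k)}$ is the submodule of $\mathbb{F}\Omega_k$ spanned by all polytabloids $\sum_{\sigma\in C_{\mathtt t}}\mathrm{sgn}(\sigma)\{\mathtt t\}\sigma$, where $\mathtt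 t$ runs over the bijective fillings by $1,\dots,n$ of the two-row Young diagram with row lengths $n-k$ and $k$, $\mathtt t_{i,j}$ is the entry in row $i$ and column $j$, $\{\mathtt t\}=\{\mathtt t_{2,1},\dots,\mathtt t_{2,k}\}$ is the set of second-row entries, and $C_{\mathtt t}=\prod_{j=1}^k\langle(\mathtt t_{1,j},\mathtt t_{2,j})\rangle\le\mathfrak{S}_n$.
   Formalization: In (1) the criterion also requires a ≤ k, and in (2) also k+a ≤ n; without these it fails, e.g. p=5, n=1, a=1 with k=0 in (1), where H_0^{/1}=0, and k=1 in (2), where H_1^{\1}=0. *)

(* Defs.v *)
From mathcomp Require Import all_boot all_order all_algebra all_fingroup.
From mathcomp Require Import mxrepresentation.
From mathcomp Require Import boolp zify.

Set Implicit Arguments.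
Unset Strict Implicit.
Unset Printing Implicit Defensive.

Import Order.TTheory GRing.Theory Num.Theory.
Local Open Scope ring_scope.

(* As in mxrepresentation, a module is a space of row vectors on which the    *)
(* group acts by right multiplication, a linear map is a matrix applied on    *)
(* the right, and a subspace is the row space of a matrix.                    *)

Section GradedModules.

Variables (F : fieldType) (gT : finGroupType) (G : {group gT}).

Record module := Module {
  mdim : nat;
  mrepr : mx_representation F G mdim }.

Definition nonvanishing_mod (M : module) : Prop := mdim M != 0.

Definition mod_isom (M N : module) : Prop := mx_rsim (mrepr M) (mrepr N).

Definition mod_hom (M N : module) (f : 'M[F]_(mdim M, mdim N)) : Prop :=
  forall x, x \in G -> mrepr M x *m f = f *m mrepr N x.

Definition mod_iso_map (M N : module) (f : 'M[F]_(mdim M, mdim N)) : Prop :=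
  [/\ mod_hom f, row_free f & row_full f].

(* A Z-graded module with an endomorphism of degree -1; the condition         *)
(* d^p = 0 is the separate predicate is_pcomplex.                             *)
Record gcomplex := GComplex {
  gterm :> int -> module;
  gdiff : forall i, 'M[F]_(mdim (gterm i), mdim (gterm (i - 1)));
  gdiffP : forall i, mod_hom (gdiff i) }.

Definition gdiff_step (C : gcomplex) (x : {i : int & 'rV[F]_(mdim (C i))}) :
    {i : int & 'rV[F]_(mdim (C i))} :=
  Tagged (fun i => 'rV[F]_(mdim (C i))) (tagged x *m gdiff C (tag x)).

Definition is_pcomplex (p : nat) (C : gcomplex) : Prop :=
  forall x, tagged (iter p (@gdiff_step C) x) = 0.

Definition nonvanishing (C : gcomplex) : Prop :=
  exists i, nonvanishing_mod (C i).

Definition gcomplex_isom (C C' : gcomplex) : Prop :=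
  exists f : forall i, 'M[F]_(mdim (C i), mdim (C' i)),
    forall i, mod_iso_map (f i)
              /\ gdiff C i *m f (i - 1) = f i *m gdiff C' i.

(* All arrows C_hi -> C_(hi-1) -> ... -> C_lo are isomorphisms. *)
Definition arrows_iso (lo hi : int) (C : gcomplex) : Prop :=
  forall i, lo < i <= hi -> mod_iso_map (gdiff C i).

End GradedModules.

Section Subquotients.

Variables (F : fieldType) (gT : finGroupType) (G : {group gT}) (m : nat).
Variable rG : mx_representation F G m.

(* Stands for sq_num / sq_den, or (sq_num + sq_den) / sq_den if sq_den is not *)
(* contained in sq_num; for slash and backslash homology in characteristic p, *)
(* and for U / rad U, the inclusion holds by slash_den_sub, backslash_den_sub *)
(* and radical_sub.                                                           *)
Record subquotient := Subquotient {
  sq_num : 'M[F]_m;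
  sq_den : 'M[F]_m;
  sq_numP : mxmodule rG sq_num;
  sq_denP : mxmodule rG sq_den }.

Definition sq_mod (X : subquotient) : module F G :=
  Module (section_repr (sq_denP X) (sq_numP X)).

(* The projection num -> num / den. *)
Definition sq_proj (X : subquotient) r (v : 'M[F]_(r, m)) :
    'M[F]_(r, mdim (sq_mod X)) :=
  in_submod _ (in_factmod (sq_den X) v).

(* A section of sq_proj. *)
Definition sq_lift (X : subquotient) r (w : 'M[F]_(r, mdim (sq_mod X))) :
    'M[F]_(r, m) :=
  val_factmod (val_submod w).

(* The map X -> Y induced by an endomorphism f of the ambient space. *)
Definition sq_map (f : 'M[F]_m) (X Y : subquotient) :
    'M[F]_(mdim (sq_mod X), mdim (sq_mod Y)) :=
  sq_proj Y (@sq_lift X _ 1%:M *m f).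

Definition sq_compat (f : 'M[F]_m) (X Y : subquotient) : Prop :=
  [/\ centgmx rG f, (sq_num X *m f <= sq_num Y)%MS
    & (sq_den X *m f <= sq_den Y)%MS].

Lemma sq_liftK X r : cancel (@sq_lift X r) (@sq_proj X r).
Proof. by move=> w; rewrite /sq_proj /sq_lift val_factmodK val_submodK. Qed.

Lemma sq_lift_sub X r (w : 'M_(r, _)) :
  (@sq_lift X r w <= sq_num X + sq_den X)%MS.
Proof.
have h : (val_submod w <= in_factmod (sq_den X) (sq_num X))%MS.
  by rewrite -(genmxE (in_factmod _ _)) val_submodP.
rewrite /sq_lift -val_factmodS in h *; apply: submx_trans h _.
by rewrite addsmxC proj_factmodS.
Qed.

Lemma sq_proj_eq0 X r (v : 'M_(r, m)) :
  (v <= sq_den X)%MS -> sq_proj X v = 0.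
Proof.
by move=> h; rewrite /sq_proj; move: h; rewrite -in_factmod_eq0 => /eqP->;
  rewrite linear0.
Qed.

Lemma sq_projE X r (v : 'M_(r, m)) : sq_proj X v = v *m sq_proj X 1%:M.
Proof.
by rewrite /sq_proj [LHS]in_submodE [in_factmod _ v]in_factmodE -mulmxA
  -in_submodE.
Qed.

Lemma sq_projK X r (v : 'M_(r, m)) : (v <= sq_num X + sq_den X)%MS ->
  (sq_lift (sq_proj X v) - v <= sq_den X)%MS.
Proof.
move=> h; have h2 : (in_factmod (sq_den X) v
    <= <<in_factmod (sq_den X) (sq_num X)>>)%MS.
  rewrite genmxE -(in_factmod_addsK _ (sq_num X)) submxMr // addsmxC //.
rewrite /sq_lift /sq_proj in_submodK // -in_factmod_eq0 linearB /=.
by rewrite val_factmodK subrr.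
Qed.

Lemma sq_mapE f X Y r (v : 'M_(r, m)) : sq_compat f X Y ->
  (v <= sq_num X + sq_den X)%MS ->
  sq_proj X v *m sq_map f X Y = sq_proj Y (v *m f).
Proof.
case=> _ _ hd hv; apply/eqP; rewrite -subr_eq0; apply/eqP.
have -> : sq_proj X v *m sq_map f X Y = sq_proj Y (sq_lift (sq_proj X v) *m f).
  rewrite /sq_map /sq_proj /sq_lift /val_factmod /val_submod /in_submod.
  by rewrite /in_factmod /= !mul1mx !mulmxA.
have -> : sq_proj Y (sq_lift (sq_proj X v) *m f) - sq_proj Y (v *m f)
    = sq_proj Y ((sq_lift (sq_proj X v) - v) *m f).
  by rewrite [in RHS]sq_projE 2!mulmxBl -!sq_projE.
by apply: sq_proj_eq0; apply: submx_trans hd; rewrite submxMr ?sq_projK.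
Qed.

Lemma sq_map1 X : sq_map 1%:M X X = 1%:M.
Proof. by rewrite /sq_map mulmx1 sq_liftK. Qed.

Lemma sq_projJ X r (v : 'M_(r, m)) x : x \in G ->
  (v <= sq_num X + sq_den X)%MS ->
  sq_proj X (v *m rG x) = sq_proj X v *m mrepr (sq_mod X) x.
Proof.
move=> Gx hv; rewrite /sq_proj (in_factmodJ (sq_denP X)) //.
rewrite (in_submodJ (section_module (sq_denP X) (sq_numP X))) //.
by rewrite genmxE -(in_factmod_addsK _ (sq_num X)) submxMr // addsmxC.
Qed.

Lemma sq_map_hom f X Y : sq_compat f X Y -> mod_hom (sq_map f X Y).
Proof.
move=> cf x Gx; case: (cf) => /centgmxP cG hn hd.
have hs := @sq_lift_sub X _ 1%:M.
have hsx : (@sq_lift X _ 1%:M *m rG x <= sq_num X + sq_den X)%MS.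
  apply: submx_trans (submxMr (rG x) hs) _.
  by apply: (mxmoduleP (addsmx_module (sq_numP X) (sq_denP X))).
rewrite -[mrepr (sq_mod X) x]mul1mx -(@sq_liftK X _ 1%:M) -sq_projJ //.
rewrite sq_mapE // -mulmxA -cG // mulmxA sq_projJ //.
apply: submx_trans (submxMr f hs) _.
by rewrite addsmxMr addsmxS.
Qed.

Definition sq0 : subquotient :=
  Subquotient (mxmodule0 rG m) (mxmodule0 rG m).

Lemma mdim_sq0 : mdim (sq_mod sq0) = 0%N.
Proof. by rewrite /= genmxE linear0 mxrank0. Qed.

Definition sq_window (lo hi : int) (X : int -> subquotient) (i : int) :=
  if lo <= i <= hi then X i else sq0.

Lemma sq_window_hom lo hi (X : int -> subquotient) f :
    (forall i, lo < i <= hi -> sq_compat f (X i) (X (i - 1))) ->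
  forall i, mod_hom (sq_map f (sq_window lo hi X i) (sq_window lo hi X (i - 1))).
Proof.
move=> hX i; rewrite /sq_window; case: ifPn => h1; last first.
  move=> x Gx; apply/matrixP=> a; exfalso; move: a; rewrite mdim_sq0 => -[] //.
case: ifPn => h2; last first.
  move=> x Gx; apply/matrixP=> a b; exfalso; move: b; rewrite mdim_sq0 => -[] //.
apply/sq_map_hom/hX; case/andP: h1 => _ ->; rewrite andbT.
by case/andP: h2 => h2 _; rewrite -lezD1 -lerBrDr.
Qed.

(* ... 0 -> X_hi -> X_(hi-1) -> ... -> X_lo -> 0 ..., with maps induced by f. *)
Definition string lo hi (X : int -> subquotient) f
    (hf : forall i, lo < i <= hi -> sq_compat f (X i) (X (i - 1))) :=
  GComplex (sq_window_hom hf).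

Lemma string_pcomplex lo hi X f hf p : hi - lo < p%:Z ->
  is_pcomplex p (@string lo hi X f hf).
Proof.
move=> hp x; set C := string _.
have tagE r : tag (iter r (@gdiff_step _ _ _ C) x) = tag x - r%:Z.
  have e (t : int) q : t - q%:Z - 1 = t - q.+1%:Z.
    by rewrite -addrA -opprD -PoszD addn1.
  by elim: r => [|r IH]; rewrite ?subr0 //= IH e.
have out i : ~~ (lo <= i <= hi) -> forall v : 'rV_(mdim (C i)), v = 0.
  move=> hi0 v; apply/matrixP=> a b; exfalso; move: b.
  by rewrite /= /sq_window (negPf hi0) [\rank _]mdim_sq0 => -[].
case h1 : (lo <= tag x <= hi).
  apply: out; rewrite tagE; apply/negP => /andP[h2 _].
  case/andP: h1 => _ h1; move: hp; rewrite ltNge => /negP; apply.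
  by rewrite lerBrDl -lerBrDr; apply: le_trans h2 _; rewrite lerD2r.
have z r : tagged (iter r (@gdiff_step _ _ _ C) x) = 0.
  elim: r => [|r IH] /=; last by rewrite IH mul0mx.
  by apply: out; rewrite h1.
exact: z.
Qed.

Definition is_radical (U R : 'M[F]_m) : Prop :=
  mxmodule rG R /\
  forall v : 'rV[F]_m, (v <= R)%MS <->
    (v <= U)%MS /\
    (forall M : 'M[F]_m, mxmodule rG M -> max_submod rG M U -> (v <= M)%MS).

Lemma radical_exists (U : 'M[F]_m) :
  mxmodule rG U -> exists R, is_radical U R.
Proof.
move=> modU.
pose Q (R : 'M_m) := [/\ mxmodule rG R, (R <= U)%MS &
  forall v : 'rV_m, (v <= U)%MS ->
    (forall M : 'M_m, mxmodule rG M -> max_submod rG M U -> (v <= M)%MS) ->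
    (v <= R)%MS].
have exQ : exists k, `[< exists2 R, Q R & \rank R = k >].
  by exists (\rank U); apply/asboolP; exists U.
case: (ex_minnP exQ) => k /asboolP[R [modR sRU hR] rR] mink.
exists R; split=> // v; split=> [hv|[hv1 hv2]]; last exact: hR.
split=> [|M modM maxM]; first exact: submx_trans hv sRU.
have : (k <= \rank (R :&: M)%MS)%N.
  apply: mink; apply/asboolP; exists (R :&: M)%MS => //; split.
  - exact: capmx_module.
  - exact: submx_trans (capmxSl _ _) sRU.
  - by move=> w hw1 hw2; rewrite sub_capmx hR // hw2.
rewrite -rR => hk; apply: submx_trans hv _.
have /eqmxP e : (R :&: M == R)%MS.
  by rewrite -(mxrank_leqif_eq (capmxSl R M)) eqn_leq mxrankS ?capmxSl.
by rewrite -e capmxSr.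
Qed.

Definition radical (U : 'M[F]_m) (modU : mxmodule rG U) : 'M[F]_m :=
  sval (cid (radical_exists modU)).

Lemma radicalP U modU : is_radical U (@radical U modU).
Proof. exact: (svalP (cid (radical_exists modU))). Qed.

Lemma radical_sub U modU : (@radical U modU <= U)%MS.
Proof.
case: (radicalP modU) => _ h; apply/rV_subP => v /h[] //.
Qed.

(* U / rad U *)
Definition sq_top (U : 'M[F]_m) (modU : mxmodule rG U) : subquotient :=
  Subquotient modU (proj1 (radicalP modU)).

End Subquotients.

Section Subsets.

Variables (F : fieldType) (n : nat).

Local Notation SymG := [set: {perm 'I_n}]%G.
Local Notation N := #|{set 'I_n}|.

(* 'rV_N is the space with basis all subsets of {0, ..., n-1}. *)
Definition eset (A : {set 'I_n}) : 'rV[F]_N := delta_mx 0 (enum_rank A).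

Definition extend_mx (g : {set 'I_n} -> 'rV[F]_N) : 'M[F]_N :=
  \matrix_i g (enum_val i).

Lemma eset_extend g A : eset A *m extend_mx g = g A.
Proof. by rewrite -rowE rowK enum_rankK. Qed.

Lemma eset_ext m (f f' : 'M[F]_(N, m)) :
  (forall A, eset A *m f = eset A *m f') -> f = f'.
Proof.
move=> h; apply/row_matrixP => i; rewrite !rowE.
by have := h (enum_val i); rewrite /eset enum_valK.
Qed.

Definition set_perm_mx (s : {perm 'I_n}) : 'M[F]_N :=
  extend_mx (fun A => eset (s @: A)).

Fact set_perm_mx_repr : mx_repr SymG set_perm_mx.
Proof.
split=> [|s t _ _]; apply: eset_ext => A.
  rewrite eset_extend mulmx1; congr eset.
  by rewrite -[RHS]imset_id; apply: eq_imset => i; rewrite perm1.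
rewrite mulmxA !eset_extend; congr eset.
by rewrite -imset_comp; apply: eq_imset => i; rewrite /= permM.
Qed.

Definition set_repr : mx_representation F SymG N :=
  MxRepresentation set_perm_mx_repr.

Definition omega_mx (k : int) : 'M[F]_N :=
  (\sum_(A : {set 'I_n} | #|A|%:Z == k) <<eset A>>)%MS.

Definition phi_mx : 'M[F]_N :=
  extend_mx (fun A => \sum_(B : {set 'I_n} | (B \subset A) && (#|B|.+1 == #|A|))
                        eset B).

(* Ker (phi_k^r), in degree k *)
Definition ker_phi (k : int) (r : nat) : 'M[F]_N :=
  (omega_mx k :&: kermx (phi_mx ^+ r))%MS.

(* Im (phi_k^r), in degree k - r *)
Definition im_phi (k : int) (r : nat) : 'M[F]_N := omega_mx k *m phi_mx ^+ r.

Lemma omega_module k : mxmodule set_repr (omega_mx k).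
Proof.
apply/mxmoduleP => s _; rewrite sumsmxMr; apply/sumsmx_subP => A hA.
rewrite (eqmxMr _ (genmxE _)) eset_extend.
apply: (submx_trans _ (sumsmx_sup (s @: A) _ (submx_refl _))).
  by rewrite genmxE.
by rewrite card_imset //; apply: perm_inj.
Qed.

Lemma phi_centgmx : centgmx set_repr phi_mx.
Proof.
apply/centgmxP => s _ /=; apply: eset_ext => A.
rewrite !mulmxA !eset_extend mulmx_suml [RHS](reindex (fun B : {set 'I_n} => s @: B)) /=.
  apply: eq_big => B; last by rewrite eset_extend.
  rewrite !card_imset; try exact: perm_inj.
  congr andb; apply/idP/idP => [|/subsetP h]; first exact: imsetS.
  apply/subsetP => i hi; have /imsetP[j hj /perm_inj->] := h _ (imset_f s hi).
  exact: hj.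
exists (fun B : {set 'I_n} => s^-1%g @: B) => B _; rewrite -imset_comp -[RHS]imset_id;
  by apply: eq_imset => i /=; rewrite ?permK ?permKV.
Qed.

Lemma phiX_centgmx r : centgmx set_repr (phi_mx ^+ r).
Proof.
apply/centgmxP => s Gs; elim: r => [|r IH]; first by rewrite mulmx1 mul1mx.
by rewrite exprS -mulmxE -mulmxA IH !mulmxA (centgmxP phi_centgmx).
Qed.

Lemma ker_phi_module k r : mxmodule set_repr (ker_phi k r).
Proof.
by apply: capmx_module; [apply: omega_module | apply/kermx_centg_module/phiX_centgmx].
Qed.

Lemma im_phi_module k r : mxmodule set_repr (im_phi k r).
Proof.
apply/mxmoduleP => s Gs; rewrite -mulmxA (centgmxP (phiX_centgmx r)) // mulmxA.
by rewrite submxMr // (mxmoduleP (omega_module k)).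
Qed.

Lemma omega_phi k : (omega_mx k *m phi_mx <= omega_mx (k - 1))%MS.
Proof.
rewrite sumsmxMr; apply/sumsmx_subP => A /eqP hA.
rewrite (eqmxMr _ (genmxE _)) eset_extend; apply: summx_sub => B /andP[_ /eqP hB].
apply: (submx_trans _ (sumsmx_sup B _ (submx_refl _))); first by rewrite genmxE.
by rewrite -hA -hB -addn1 PoszD addrK.
Qed.

Lemma omega_phiX k r : (omega_mx k *m phi_mx ^+ r <= omega_mx (k - r%:Z))%MS.
Proof.
elim: r => [|r IH]; first by rewrite mulmx1 subr0.
rewrite exprSr -mulmxE mulmxA; apply: submx_trans (submxMr _ IH) _.
by apply: submx_trans (omega_phi _) _; rewrite -addn1 PoszD opprD addrA.
Qed.

Lemma ker_phi_phi k r : (ker_phi k r.+1 *m phi_mx <= ker_phi (k - 1) r)%MS.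
Proof.
rewrite sub_capmx (submx_trans (submxMr _ (capmxSl _ _)) (omega_phi k)) /=.
apply/sub_kermxP; rewrite -mulmxA mulmxE -exprS -mulmxE.
by apply/sub_kermxP; apply: capmxSr.
Qed.

Lemma im_phi_phi k r : im_phi k r *m phi_mx = im_phi k r.+1.
Proof. by rewrite /im_phi exprSr -mulmxE mulmxA. Qed.

Lemma eset_phiX A r : eset A *m phi_mx ^+ r =
  r`!%:R *: \sum_(B : {set 'I_n} | (B \subset A) && (#|B| + r == #|A|)%N) eset B.
Proof.
elim: r => [|r IH].
  rewrite mulmx1 scale1r (big_pred1 A) // => B; rewrite /= addn0 eqEcard.
  by apply: andb_id2l => h; rewrite eqn_leq (subset_leq_card h).
rewrite exprSr -mulmxE mulmxA IH -scalemxAl mulmx_suml.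
under eq_bigr => B _ do rewrite eset_extend.
rewrite (exchange_big_dep (fun C : {set 'I_n} => (C \subset A)
    && (#|C| + r.+1 == #|A|)%N)) /=; last first.
  move=> B C /andP[hB /eqP hB2] /andP[hC /eqP hC2].
  by rewrite (subset_trans hC hB) -hB2 -hC2 addSnnS eqxx.
rewrite factS mulnC natrM -scalerA; congr (_ *: _); rewrite scaler_sumr.
apply: eq_bigr => C /andP[hC /eqP hC2]; rewrite sumr_const -scaler_nat.
congr (_%:R *: _).
have <- : #|[set x |: C | x in A :\: C]| = r.+1.
  rewrite card_in_imset ?cardsD ?(setIidPr hC) -?hC2 ?addKn // => x y.
  rewrite !inE => /andP[hx _] /andP[hy _] /setP/(_ x).
  by rewrite !inE eqxx (negPf hx) !orbF => /esym/eqP.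
apply: eq_card => B; apply/idP/imsetP => [|[x]].
  rewrite !unfold_in /= => /andP[/andP[hB /eqP hB2] /andP[hCB /eqP hCB2]].
  have /cards1P[x hx] : #|B :\: C| == 1%N.
    by rewrite cardsD (setIidPr hCB) -hCB2 subSnn.
  have : x \in B :\: C by rewrite hx inE.
  rewrite inE => /andP[xC xB]; exists x; first by rewrite inE xC (subsetP hB).
  by rewrite -[LHS](setID B C) (setIidPr hCB) hx setUC.
rewrite inE => /andP[xC xA] ->; rewrite !unfold_in /= subUset sub1set xA hC /=.
by rewrite cardsU1 xC -hC2 addSnnS eqxx subsetUr eqxx.
Qed.

Lemma phiX_eq0 p : p \in [pchar F] -> phi_mx ^+ p = 0.
Proof.
move=> hp; apply: eset_ext => A; rewrite eset_phiX mulmx0.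
have /eqP -> : (p`!%:R == 0 :> F); last by rewrite scale0r.
by rewrite -(dvdn_pcharf hp) dvdn_fact // prime_gt0 //= (pcharf_prime hp).
Qed.

(* The entries of the two rows of a filling of the diagram (n - k, k); zip    *)
(* pairs the entries of each of the first k columns.                          *)
Local Notation filling k := ((n - k).-tuple 'I_n * k.-tuple 'I_n)%type.

Definition column_group k (t : filling k) : {set {perm 'I_n}} :=
  (\prod_(x <- zip t.1 t.2) <[tperm x.1 x.2]>)%g.

Definition polytabloid k (t : filling k) : 'rV[F]_N :=
  \sum_(s in column_group t)
     (-1) ^+ odd_perm s *: (eset [set x in t.2] *m set_repr s).

(* For k <= n the rows have n entries in total, so that "uniq" says that the  *)
(* filling is bijective.                                                      *)
Definition specht_mx (k : nat) : 'M[F]_N :=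
  (\sum_(t : filling k | uniq (t.1 ++ t.2)) <<polytabloid t>>)%MS.

Definition filling_act k (g : {perm 'I_n}) (t : filling k) : filling k :=
  ([tuple of map g t.1], [tuple of map g t.2]).

Lemma column_group_act k g (t : filling k) :
  column_group (filling_act g t) = (column_group t :^ g)%g.
Proof.
rewrite /column_group /=.
have -> : zip (map g t.1) (map g t.2) = [seq (g x.1, g x.2) | x <- zip t.1 t.2].
  by elim: (tval t.1) (tval t.2) => [|x r IH] [|y r'] //=; rewrite IH.
rewrite big_map /=.
elim: (zip _ _) => [|x r IH]; first by rewrite !big_nil conjs1g.
by rewrite !big_cons conjsMg IH -tpermJ cycleJ.
Qed.

Lemma polytabloid_act k g (t : filling k) :
  polytabloid t *m set_repr g = polytabloid (filling_act g t).
Proof.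
rewrite /polytabloid column_group_act mulmx_suml.
rewrite [RHS](reindex (fun s => s ^ g)%g) /=; last first.
  by exists (fun s => s ^ g^-1)%g => s _; rewrite ?conjgK ?conjgKV.
apply: eq_big => s; first by rewrite memJ_conjg.
move=> _; rewrite -scalemxAl odd_permJ; congr (_ *: _).
rewrite !eset_extend; congr eset; rewrite -!imset_comp.
have -> : [set x in map g t.2] = g @: [set x in t.2].
  apply/setP => i; rewrite inE; apply/mapP/imsetP => -[j hj ->]; exists j => //.
    by rewrite inE.
  by rewrite inE in hj.
rewrite -imset_comp; apply: eq_imset => i /=.
by rewrite /conjg !permM permK.
Qed.

Lemma specht_module k : mxmodule set_repr (specht_mx k).
Proof.
apply/mxmoduleP => g _; rewrite sumsmxMr; apply/sumsmx_subP => t ht.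
rewrite (eqmxMr _ (genmxE _)) polytabloid_act.
apply: (submx_trans _ (sumsmx_sup (filling_act g t) _ (submx_refl _))).
  by rewrite genmxE.
by rewrite /= -map_cat map_inj_uniq //; apply: perm_inj.
Qed.

(* D^(n-k,k) *)
Definition D_sq (k : nat) : subquotient set_repr := sq_top (specht_module k).
Definition D_mod (k : nat) := sq_mod (D_sq k).

Variable p : nat.

Definition slash_sq (k : int) (a : nat) : subquotient set_repr :=
  Subquotient (ker_phi_module k a.+1)
    (addsmx_module (im_phi_module (k + (p - a - 1)%:Z) (p - a - 1))
                   (ker_phi_module k a)).

Definition backslash_sq (k : int) (a : nat) : subquotient set_repr :=
  Subquotient
    (capmx_module (im_phi_module (k + a%:Z) a) (ker_phi_module k (p - a - 1)))
    (im_phi_module (k + a%:Z + 1) a.+1).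

(* H_k^{/a} and H_k^{\a}; these are meaningful for a <= p - 2 only. *)
Definition H_slash k a := sq_mod (slash_sq k a).
Definition H_backslash k a := sq_mod (backslash_sq k a).

Lemma slash_den_sub k a : p \in [pchar F] -> (a <= p - 2)%N ->
  (sq_den (slash_sq k a) <= sq_num (slash_sq k a))%MS.
Proof.
move=> hp ha; have p1 := prime_gt1 (pcharf_prime hp).
have e : (p - a - 1 + a.+1 = p)%N by move: ha p1; clear; lia.
rewrite addsmx_sub; apply/andP; split; rewrite sub_capmx; apply/andP; split.
- by apply: submx_trans (omega_phiX _ _) _; rewrite addrK.
- apply/sub_kermxP; rewrite /im_phi -mulmxA mulmxE -exprD e phiX_eq0 //.
  by rewrite -mulmxE mulmx0.
- exact: capmxSl.
apply/sub_kermxP; rewrite exprSr -mulmxE mulmxA.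
by rewrite (sub_kermxP (capmxSr _ _)) mul0mx.
Qed.

Lemma backslash_den_sub k a : p \in [pchar F] -> (a <= p - 2)%N ->
  (sq_den (backslash_sq k a) <= sq_num (backslash_sq k a))%MS.
Proof.
move=> hp ha; have p1 := prime_gt1 (pcharf_prime hp).
have e : (a.+1 + (p - a - 1) = p)%N by move: ha p1; clear; lia.
rewrite !sub_capmx /=; apply/and3P; split.
- rewrite /im_phi exprS -mulmxE mulmxA submxMr //.
  by apply: submx_trans (omega_phi _) _; rewrite addrK.
- apply: submx_trans (omega_phiX _ _) _.
  by rewrite -addn1 PoszD opprD addrA addrAC addrK addrK.
apply/sub_kermxP; rewrite /im_phi -mulmxA mulmxE -exprD e phiX_eq0 //.
by rewrite -mulmxE mulmx0.
Qed.

Lemma slash_compat k a : (0 < a)%N ->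
  sq_compat phi_mx (slash_sq k a) (slash_sq (k - 1) a.-1).
Proof.
case: a => // a _; split; first exact: phi_centgmx.
  exact: ker_phi_phi.
rewrite addsmxMr addsmxS ?ker_phi_phi // im_phi_phi /=.
have [h|h] := leqP (a + 2) p.
  have -> : (p - a - 1 = (p - a.+1 - 1).+1)%N by move: h; clear; lia.
  suff -> : k - 1 + (p - a.+1 - 1).+1%:Z = k + (p - a.+1 - 1)%:Z by [].
  by rewrite -[(p - a.+1 - 1).+1]add1n PoszD addrA subrK.
have -> : (p - a - 1 = 0)%N by move: h; clear; lia.
have -> : (p - a.+1 - 1 = 0)%N by move: h; clear; lia.
by rewrite -im_phi_phi /im_phi !mulmx1 !addr0 omega_phi.
Qed.

Lemma backslash_compat k a :
  sq_compat phi_mx (backslash_sq k a) (backslash_sq (k - 1) a.+1).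
Proof.
have e : k - 1 + a.+1%:Z = k + a%:Z.
  by rewrite -[a.+1]add1n PoszD addrA subrK.
split; first exact: phi_centgmx; last by rewrite /= e im_phi_phi.
rewrite /= e sub_capmx -im_phi_phi submxMr ?capmxSl //=.
have [h|h] := leqP (a + 2) p.
  apply: submx_trans (submxMr _ (capmxSr _ _)) _.
  have -> : (p - a - 1 = (p - a.+1 - 1).+1)%N by move: h; clear; lia.
  exact: ker_phi_phi.
have -> : (p - a - 1 = 0)%N by move: h; clear; lia.
have -> : (im_phi (k + a%:Z) a :&: ker_phi k 0)%MS = 0.
  apply/eqP; rewrite -submx0; apply: submx_trans (capmxSr _ _) _.
  have := capmxSr (omega_mx k) (kermx (phi_mx ^+ 0)).
  by move/sub_kermxP; rewrite mulmx1 => h0; rewrite /ker_phi h0 sub0mx.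
by rewrite mul0mx sub0mx.
Qed.

Lemma slash_string_compat (k hi i : int) : k < i <= hi ->
  sq_compat phi_mx (slash_sq i `|(i - k)%R|%N) (slash_sq (i - 1) `|(i - 1 - k)%R|%N).
Proof.
move=> h; have -> : `|(i - 1 - k)%R|%N = `|(i - k)%R|%N.-1 by move: h; clear; lia.
by apply: slash_compat; move: h; clear; lia.
Qed.

Lemma backslash_string_compat (k lo i : int) : lo < i <= k ->
  sq_compat phi_mx (backslash_sq i `|(k - i)%R|%N) (backslash_sq (i - 1) `|(k - (i - 1))%R|%N).
Proof.
move=> h; have -> : `|(k - (i - 1))%R|%N = `|(k - i)%R|%N.+1 by move: h; clear; lia.
exact: backslash_compat.
Qed.

(* H_hi^{/hi-k} -> ... -> H_(k+1)^{/1} -> H_k^{/0}, with the maps induced by  *)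
(* phi.                                                                       *)
Definition slash_row (k hi : int) : gcomplex F SymG :=
  string (@slash_string_compat k hi).

(* H_k^{\0} -> H_(k-1)^{\1} -> ... -> H_lo^{\k-lo} *)
Definition backslash_row (k lo : int) : gcomplex F SymG :=
  string (@backslash_string_compat k lo).

(* As a ranges over 0, ..., p - 2, the degrees k + a (resp. k - a) range over *)
(* the windows below.                                                         *)
Definition slash_homology (k : int) := slash_row k (k + (p - 2)%:Z).
Definition backslash_homology (k : int) := backslash_row k (k - (p - 2)%:Z).

Lemma slash_pcomplex k : (1 < p)%N -> is_pcomplex p (slash_homology k).
Proof. by move=> hp; apply: string_pcomplex; move: hp; clear; lia. Qed.

Lemma backslash_pcomplex k : (1 < p)%N -> is_pcomplex p (backslash_homology k).
Proof. by move=> hp; apply: string_pcomplex; move: hp; clear; lia. Qed.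

Lemma D_row_compat k (lo hi i : int) : lo < i <= hi ->
  sq_compat 1%:M (D_sq k) (D_sq k).
Proof.
by move=> _; split; rewrite ?mulmx1 //; apply/centgmxP => x _;
  rewrite mul1mx mulmx1.
Qed.

(* D -> D -> ... -> D in degrees hi, ..., lo, with D = D^(n-k,k); the arrows  *)
(* are identities by sq_map1.                                                 *)
Definition D_row (k : nat) (lo hi : int) : gcomplex F SymG :=
  string (X := fun=> D_sq k) (@D_row_compat k lo hi).

End Subsets.

(* Main.v *)
Require Import Defs.
From mathcomp Require Import all_boot all_order all_algebra all_fingroup.
From mathcomp Require Import cyclic mxrepresentation.
From mathcomp Require Import zify.
Import Order.TTheory GRing.Theory Num.Theory.
Local Open Scope ring_scope.

Set Implicit Arguments.
Unset Strict Implicit.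
Unset Printing Implicit Defensive.

(* Identify a set with a square-free monomial in x_1, ..., x_n. Then phi is the
   sum of the partial derivatives d_a, and with the multiplication psi by the sum
   of the x_a it generates an action of sl_2 for which degree k has weight
   n - 2k. A vector of Ker phi of weight m < p therefore lies at the bottom of a
   string of length m + 1.

   Removing one letter at a time, an induction on the ground set shows that in
   degree k with m = n - 2k in [0, p - 2] one has Ker phi = S + Im phi^(p-1) and
   that the vectors of Ker phi orthogonal to the polytabloids lie in
   Im phi^(p-1); for all other m, Ker phi is contained in Im phi^(p-1).
   Polytabloids are orthogonal to Im phi^(m+1), because psi^(m+1) kills them.
   With James' submodule theorem this gives rad S = S & Im phi^(p-1), hence
   H_k^{/0} = D. Everything else follows by pushing along powers of phi: all
   strings counted by the homology in question run from degree n - k to k. *)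

(** * Monomials and partial derivatives *)

(** Removing a letter [a] writes a vector of weight m as v0 + v1 x_a, with parts of weights m - 1
    and m + 1 over the smaller ground set. Orthogonality to polytabloids is assumed only for m in
    [0, p - 2], so it cannot be passed on when m just misses this range, that is for m = -1 and m =
    p - 1. At these two weights, however, the sl_2 scalars met along psi^(p-1) are all invertible,
    and a preimage under phi^(p-1) can be written down. The two homologies meet in the bottom degree
    k of a string: the identity of degree k identifies Ker phi / Im phi^(p-1) with the backslash
    term at place m = n - 2k. Oddness of p enters through the pairing of a polytabloid with itself,
    which is 2^k; for p = 2 multiplication by a single letter contracts the complex. *)

Section Operators.

Variables (F : fieldType) (n : nat).
Local Notation N := #|{set 'I_n}|.
Local Notation phi := (phi_mx F n).
Local Notation eset := (eset F).
Implicit Types (a b c : 'I_n) (A B D : {set 'I_n}) (v w u : 'rV[F]_N).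

Definition coeff v B : F := v 0 (enum_rank B).

Lemma coeffZ (z : F) v B : coeff (z *: v) B = z * coeff v B.
Proof. by rewrite /coeff mxE. Qed.

Lemma coeff_eset A B : coeff (eset A) B = (A == B)%:R.
Proof. by rewrite /coeff mxE eqxx (inj_eq enum_rank_inj) eq_sym. Qed.

Lemma coeffP v w : (forall B, coeff v B = coeff w B) -> v = w.
Proof.
by move=> h; apply/rowP=> i; have := h (enum_val i); rewrite /coeff enum_valK.
Qed.

Lemma coeff_sum v : v = \sum_B coeff v B *: eset B.
Proof.
rewrite {1}[v]row_sum_delta (reindex enum_rank); last first.
  by apply: onW_bij; apply: enum_rank_bij.
by apply: eq_bigr => B _.
Qed.

(* Multiplication by x_a in F[x_1, ..., x_n] / (x_i ^ 2), where a set stands for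
   the product of its elements, and differentiation in x_a. *)
Definition ins a : 'M[F]_N :=
  extend_mx (fun A => if a \in A then 0 else eset (a |: A)).
Definition del a : 'M[F]_N :=
  extend_mx (fun A => if a \in A then eset (A :\ a) else 0).

Lemma eset_ins a A : eset A *m ins a = if a \in A then 0 else eset (a |: A).
Proof. exact: eset_extend. Qed.

Lemma eset_del a A : eset A *m del a = if a \in A then eset (A :\ a) else 0.
Proof. exact: eset_extend. Qed.

(** Multiplication and differentiation are adjoint for the form [v *m w^T], in which the sets are
    orthonormal. All orthogonality arguments below rest on this. *)
Lemma tr_ins a : (ins a)^T = del a.
Proof.
apply/matrixP => i j; rewrite !mxE.
set A := enum_val j; set B := enum_val i.
have -> : j = enum_rank A by rewrite /A enum_valK.
have -> : i = enum_rank B by rewrite /B enum_valK.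
have e C C' : (if a \in C then eset C' else 0) 0 (enum_rank A) = ((a \in C) && (C' == A))%:R.
  by case: ifP => _; [exact: coeff_eset | rewrite mxE].
have e' C C' : (if a \in C then 0 else eset C') 0 (enum_rank B) = ((a \notin C) && (C' == B))%:R.
  by case: ifP => _; [rewrite mxE | exact: coeff_eset].
rewrite e e'; congr (_%:R); congr (nat_of_bool _).
apply/andP/andP=> -[h1 /eqP h2].
  by rewrite -h2 setU11; split=> //; rewrite setU1K.
by rewrite -h2 !inE eqxx setD1K.
Qed.

Lemma tr_del a : (del a)^T = ins a.
Proof. by rewrite -tr_ins trmxK. Qed.

Lemma ins_ins a b : ins a *m ins b = ins b *m ins a.
Proof.
apply: eset_ext => A; rewrite !mulmxA !eset_ins.
case ha: (a \in A); case hb: (b \in A);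
  rewrite ?mul0mx ?eset_ins ?inE ?ha ?hb ?orbT ?orbF ?[b == a]eq_sym //.
by case: eqP => // _; rewrite setUCA.
Qed.

Lemma insK a : ins a *m ins a = 0.
Proof.
apply: eset_ext => A; rewrite mulmxA eset_ins mulmx0.
by case: ifP => ha; rewrite ?mul0mx // eset_ins setU11.
Qed.

Lemma del_del a b : del a *m del b = del b *m del a.
Proof. by rewrite -!tr_ins -!trmx_mul ins_ins. Qed.

Lemma delK a : del a *m del a = 0.
Proof. by rewrite -tr_ins -trmx_mul insK trmx0. Qed.

Lemma del_ins a b : a != b -> del a *m ins b = ins b *m del a.
Proof.
move=> ab; apply: eset_ext => A; rewrite !mulmxA eset_ins eset_del.
case ha: (a \in A); case hb: (b \in A);
  rewrite ?mul0mx ?eset_ins ?eset_del ?inE ?ha ?hb ?[b == a]eq_sym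
    ?(negPf ab) ?orbT ?orbF //=.
congr eset; apply/setP => c; rewrite !inE.
by case: (c =P b) => [->|] //=; rewrite eq_sym ab.
Qed.

Lemma ins_del a : ins a *m del a = 1%:M - del a *m ins a.
Proof.
apply: eset_ext => A; rewrite mulmxBr mulmx1 !mulmxA eset_ins eset_del.
case: (boolP (a \in A)) => ha.
  by rewrite mul0mx eset_ins !inE eqxx /= setD1K // subrr.
by rewrite mul0mx subr0 eset_del setU11 setU1K.
Qed.

Lemma phiE : phi = \sum_a del a.
Proof.
apply: eset_ext => A; rewrite eset_extend mulmx_sumr.
under [RHS]eq_bigr => a _ do rewrite eset_del.
rewrite -big_mkcond /=.
have hinj : {in A &, injective (fun a => A :\ a)}.
  move=> a b ha hb /setP /(_ a); rewrite !inE eqxx ha /= andbT => /esym/negbFE/eqP.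
  by [].
rewrite -(big_imset _ hinj) /=; apply: eq_bigl => B.
apply/andP/imsetP => [[hB /eqP hc]|[a ha ->]]; last first.
  by rewrite subD1set (cardsD1 a A) ha.
have /cards1P[x hx] : #|A :\: B| == 1%N.
  by rewrite cardsD (setIidPr hB) -hc subSnn.
have : x \in A :\: B by rewrite hx inE.
rewrite inE => /andP[xB xA]; exists x => //.
by rewrite -hx setDDr setDv set0U (setIidPr hB).
Qed.

Lemma del_phi a : del a *m phi = phi *m del a.
Proof.
rewrite phiE mulmx_sumr mulmx_suml; apply: eq_bigr => b _; exact: del_del.
Qed.

Lemma del_phiX a r : del a *m phi ^+ r = phi ^+ r *m del a.
Proof.
elim: r => [|r IH]; first by rewrite mulmx1 mul1mx.
by rewrite exprS -mulmxE mulmxA del_phi -!mulmxA IH.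
Qed.

Lemma ins_phi a :
  ins a *m phi = phi *m ins a + (ins a *m del a - del a *m ins a).
Proof.
rewrite phiE mulmx_sumr mulmx_suml (bigD1 a) //= [in RHS](bigD1 a) //=.
rewrite [RHS]addrC addrA subrK; congr (_ + _).
by apply: eq_bigr => b ab; rewrite del_ins.
Qed.

Lemma ins_phi_free a v : v *m del a = 0 ->
  v *m ins a *m phi = v *m phi *m ins a + v.
Proof.
move=> h; rewrite -mulmxA ins_phi mulmxDr mulmxA ins_del; congr (_ + _).
by rewrite 2!mulmxBr mulmx1 mulmxA h mul0mx !subr0.
Qed.

(** The ground set [D] is a parameter because the inductions shrink it, while [phi] keeps all
    letters. On vectors supported on [D] it agrees with [phiD D], the transpose of [psi D]. *)
Definition psi D : 'M[F]_N := \sum_(a in D) ins a.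
Definition phiD D : 'M[F]_N := \sum_(a in D) del a.

Lemma tr_psi D : (psi D)^T = phiD D.
Proof. by rewrite /psi linear_sum; apply: eq_bigr => a _; rewrite /= tr_ins. Qed.

Lemma psi_phi D :
  psi D *m phi = phi *m psi D + \sum_(a in D) (ins a *m del a - del a *m ins a).
Proof.
rewrite mulmx_suml mulmx_sumr -big_split /=; apply: eq_bigr => a _.
exact: ins_phi.
Qed.

(** * Homogeneous vectors supported on a ground set *)

Definition subset_span D (k : int) : 'M[F]_N :=
  (\sum_(A : {set 'I_n} | (A \subset D) && (#|A|%:Z == k)) <<eset A>>)%MS.
Local Notation U := subset_span.

Lemma omegaE k : (omega_mx F n k :=: U setT k)%MS.
Proof.
suff -> : omega_mx F n k = U setT k by [].
by apply: eq_bigl => A; rewrite subsetT.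
Qed.

Lemma eset_sub D k A : A \subset D -> #|A|%:Z = k -> (eset A <= U D k)%MS.
Proof.
by move=> h1 h2; rewrite (sumsmx_sup A) ?genmxE // h1 h2 eqxx.
Qed.

Lemma in_UP D k v :
  reflect (forall B, coeff v B != 0 -> (B \subset D) && (#|B|%:Z == k))
    (v <= U D k)%MS.
Proof.
apply: (iffP idP) => [hv B hB|h]; last first.
  rewrite [v]coeff_sum summx_sub // => B _; have [->|/h/andP[h1 /eqP h2]] := eqVneq (coeff v B) 0.
    by rewrite scale0r sub0mx.
  by rewrite scalemx_sub // eset_sub.
apply: contraR hB => hB; have : (U D k <= kermx (eset B)^T)%MS.
  apply/sumsmx_subP => A hA; rewrite genmxE; apply/sub_kermxP/rowP => i.
  rewrite mxE (bigD1 (enum_rank B)) //= big1 ?addr0 => [|j hj].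
    rewrite -/(coeff _ _) coeff_eset.
    have [e|_] := eqVneq A B; last by rewrite mul0r mxE.
    by rewrite -e hA in hB.
  by rewrite !mxE (negPf hj) andbF mulr0.
move/(submx_trans hv)/sub_kermxP/rowP => /(_ 0).
rewrite mxE (bigD1 (enum_rank B)) //= big1 ?addr0 => [|j hj].
  by rewrite [X in _ * X]mxE [RHS]mxE -!/(coeff _ _) coeff_eset eqxx mulr1 => /eqP.
by rewrite !mxE (negPf hj) andbF mulr0.
Qed.

Lemma U_ext D k m (f g : 'M[F]_(N, m)) v :
  (forall A, A \subset D -> #|A|%:Z = k -> eset A *m f = eset A *m g) ->
  (v <= U D k)%MS -> v *m f = v *m g.
Proof.
move=> h /in_UP hv; rewrite [v]coeff_sum !mulmx_suml; apply: eq_bigr => B _.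
rewrite -!scalemxAl; have [->|/hv/andP[h1 /eqP h2]] := eqVneq (coeff v B) 0.
  by rewrite !scale0r.
by rewrite h.
Qed.

Lemma U_map D k D' k' (f : 'M[F]_N) v :
  (forall A, A \subset D -> #|A|%:Z = k -> (eset A *m f <= U D' k')%MS) ->
  (v <= U D k)%MS -> (v *m f <= U D' k')%MS.
Proof.
move=> h /in_UP hv; rewrite [v]coeff_sum !mulmx_suml; apply: summx_sub => B _.
rewrite -!scalemxAl; have [->|/hv/andP[h1 /eqP h2]] := eqVneq (coeff v B) 0.
  by rewrite !scale0r sub0mx.
by rewrite scalemx_sub // h.
Qed.

Lemma U_mono D D' k : D \subset D' -> (U D k <= U D' k)%MS.
Proof.
move=> h; apply/rV_subP => v /in_UP hv; apply/in_UP => B /hv /andP[h1 ->].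
by rewrite (subset_trans h1).
Qed.

Lemma U_eq0 D k v : (v <= U D k)%MS -> (k < 0) || (#|D|%:Z < k) -> v = 0.
Proof.
move=> /in_UP hv hk; apply: coeffP => B; rewrite [RHS]mxE.
apply/eqP; apply: contraT => /hv /andP[/subset_leq_card h1 /eqP h2].
by exfalso; move: h1 h2 hk; clear; lia.
Qed.

Lemma U_del D k a v : (v <= U D k)%MS -> (v *m del a <= U (D :\ a) (k - 1))%MS.
Proof.
apply: U_map => A hA hk; rewrite eset_del; case: ifP => ha; rewrite ?sub0mx //.
apply: eset_sub; first by rewrite setSD.
by rewrite -hk (cardsD1 a A) ha addnC PoszD addrK.
Qed.

Lemma U_del0 D k a v : a \notin D -> (v <= U D k)%MS -> v *m del a = 0.
Proof.
move=> ha h; rewrite -[RHS](mulmx0 _ v); apply: U_ext h => A hA hk.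
rewrite mulmx0 eset_del ifN //; apply: contra ha; exact: (subsetP hA).
Qed.

Lemma U_ins D k a v : a \in D -> (v <= U D k)%MS -> (v *m ins a <= U D (k + 1))%MS.
Proof.
move=> hD; apply: U_map => A hA hk; rewrite eset_ins.
case: ifP => ha; rewrite ?sub0mx //.
apply: eset_sub; first by rewrite subUset sub1set hD.
by rewrite -hk cardsU1 ha; lia.
Qed.

(** The coefficient of a set B containing [a] reappears in [v *m del a] at [B :\ a], to which no
    other set contributes. *)
Lemma U_D1 D k a v : (v <= U D k)%MS -> v *m del a = 0 -> (v <= U (D :\ a) k)%MS.
Proof.
move=> /in_UP hv h0; apply/in_UP => B hB; case/andP: (hv _ hB) => h1 ->.
rewrite andbT subsetD1 h1 /=; apply: contra hB => ha.
have : coeff (v *m del a) (B :\ a) = 0 by rewrite h0 /coeff mxE.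
rewrite {1}[v]coeff_sum mulmx_suml /coeff summxE (bigD1 B) //= big1 ?addr0 => [|C hC].
  by rewrite -scalemxAl mxE eset_del ha -/(coeff (eset _) _) coeff_eset eqxx mulr1 => ->.
rewrite -scalemxAl mxE eset_del; case: ifP => hCa; last by rewrite mxE mulr0.
rewrite -/(coeff (eset _) _) coeff_eset; case: eqP => [e|]; last by rewrite mulr0.
by case/eqP: hC; rewrite -(setD1K hCa) e setD1K.
Qed.

Lemma U_psi D k v : (v <= U D k)%MS -> (v *m psi D <= U D (k + 1))%MS.
Proof.
by move=> h; rewrite mulmx_sumr; apply: summx_sub => a ha; apply: U_ins.
Qed.

Lemma U_psiX D k r v : (v <= U D k)%MS -> (v *m psi D ^+ r <= U D (k + r%:Z))%MS.
Proof.
move=> h; elim: r => [|r IH]; first by rewrite mulmx1 addr0.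
rewrite exprSr -mulmxE mulmxA -(addn1 r) PoszD addrA; exact: U_psi.
Qed.

Lemma U_phi D k v : (v <= U D k)%MS -> (v *m phi <= U D (k - 1))%MS.
Proof.
move=> h; rewrite phiE mulmx_sumr; apply: summx_sub => a _.
exact: submx_trans (U_del a h) (U_mono _ (subD1set _ _)).
Qed.

Lemma U_phiX D k r v : (v <= U D k)%MS -> (v *m phi ^+ r <= U D (k - r%:Z))%MS.
Proof.
move=> h; elim: r => [|r IH]; first by rewrite mulmx1 subr0.
rewrite exprSr -mulmxE mulmxA -(addn1 r) PoszD opprD addrA; exact: U_phi.
Qed.

Lemma phi_phiD D k v : (v <= U D k)%MS -> v *m phi = v *m phiD D.
Proof.
move=> h; rewrite phiE /phiD [in RHS]big_mkcond !mulmx_sumr; apply: eq_bigr => a _.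
by case: ifPn => // ha; rewrite (U_del0 ha h) mulmx0.
Qed.

Lemma phiX_phiD D k r v : (v <= U D k)%MS -> v *m phi ^+ r = v *m phiD D ^+ r.
Proof.
move=> h; elim: r => [|r IH]; first by rewrite !mulmx1.
rewrite !exprSr -!mulmxE !mulmxA -IH; apply: phi_phiD; exact: U_phiX h.
Qed.

(** On a set A, a letter of [D] contributes -1 to the commutator if it lies in A and 1 otherwise.
    The total #|D| - 2k is the sl_2 weight. *)
Lemma psi_phi_U D k v : (v <= U D k)%MS ->
  v *m psi D *m phi = v *m phi *m psi D + (#|D|%:Z - 2 * k)%:~R *: v.
Proof.
move=> h; rewrite -mulmxA psi_phi mulmxDr mulmxA; congr (_ + _).
rewrite -mul_mx_scalar; apply: U_ext h => A hA hk; rewrite mul_mx_scalar mulmx_sumr.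
have e a : a \in D -> eset A *m (ins a *m del a - del a *m ins a) =
   (if a \in A then -1 else 1) *: eset A.
  move=> ha; rewrite mulmxBr !mulmxA eset_ins eset_del.
  case: ifP => hA'; rewrite mul0mx ?sub0r ?subr0.
    by rewrite eset_ins !inE eqxx /= setD1K // scaleN1r.
  by rewrite eset_del setU11 scale1r setU1K // hA'.
rewrite (eq_bigr _ e) -scaler_suml; congr (_ *: _).
transitivity (\sum_(a in D) (1 - (if a \in A then 2 else 0)) : F).
  by apply: eq_bigr => a _; case: ifP => _; rewrite ?subr0 // opprD addrA subrr add0r.
rewrite sumrB sumr_const -big_mkcondr /= (eq_bigl (mem A)) => [|a].
  by rewrite sumr_const -hk rmorphB rmorphM /= -!pmulrn mulr_natr.
by apply/andP/idP => [[]|h1] //; split=> //; apply: (subsetP hA).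
Qed.

End Operators.

Lemma int_pchar_neq0 (R : nzRingType) p (z : int) :
  p \in [pchar R] -> 0 < `|z| < p%:Z -> z%:~R != 0 :> R.
Proof.
move=> hp hz; have e (k : nat) : (0 < k < p)%N -> k%:R != 0 :> R.
  by move=> /andP[h1 h2]; rewrite -(dvdn_pcharf hp) gtnNdvd.
case: z hz => k hz; first by apply: e; move: hz; clear; lia.
by rewrite NegzE mulrNz oppr_eq0; apply: e; move: hz; clear; lia.
Qed.

(** * Highest weight vectors *)

Section HighestWeight.

Variables (F : fieldType) (n : nat).
Local Notation N := #|{set 'I_n}|.
Local Notation phi := (phi_mx F n).
Local Notation eset := (eset F).
Local Notation U := (subset_span F).
Local Notation ins := (ins F).
Local Notation del := (del F).
Local Notation psi := (psi F).
Local Notation phiD := (phiD F).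
Implicit Types (a b c : 'I_n) (A B D : {set 'I_n}) (v w u : 'rV[F]_N).
Implicit Types (zs : seq ('I_n * 'I_n)).

(** With m the weight of [v], moving [phi] past r + 1 factors [psi D] collects m, m - 2, ..., m -
    2r, whose sum is (r + 1) (m - r). *)
Lemma psi_phi_hw D k v r : (v <= U D k)%MS -> v *m phi = 0 ->
  v *m psi D ^+ r.+1 *m phi
  = (r.+1%:Z * (#|D|%:Z - 2 * k - r%:Z))%:~R *: (v *m psi D ^+ r).
Proof.
move=> vU v0; elim: r => [|r IH].
  by rewrite expr1 mulmx1 (psi_phi_U vU) v0 mul0mx add0r mul1r subr0.
rewrite exprSr -mulmxE mulmxA (psi_phi_U (U_psiX r.+1 vU)) IH.
rewrite -scalemxAl -mulmxA mulmxE -exprSr -scalerDl -rmorphD /=.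
by congr (_%:~R *: _); clear; lia.
Qed.

Lemma psiX_phiX_hw D k v r : (v <= U D k)%MS -> v *m phi = 0 ->
  v *m psi D ^+ r *m phi ^+ r
  = (\prod_(i < r) (i.+1%:Z * (#|D|%:Z - 2 * k - i%:Z))%:~R) *: v.
Proof.
move=> vU v0; elim: r => [|r IH]; first by rewrite big_ord0 scale1r !mulmx1.
rewrite [phi ^+ _]exprS -mulmxE mulmxA (psi_phi_hw _ vU v0) -scalemxAl IH.
by rewrite scalerA big_ord_recr /= mulrC.
Qed.

(** A multiple of [v *m psi D ^+ r] works as soon as 1, ..., r and m, m - 1, ..., m - r + 1 are
    prime to p. For m = -1 the latter are -1, ..., -r. *)
Lemma hw_lift p D k v (r : nat) : p \in [pchar F] ->
  (v <= U D k)%MS -> v *m phi = 0 -> r%:Z < p%:Z ->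
  (r%:Z <= #|D|%:Z - 2 * k < p%:Z) || (#|D|%:Z - 2 * k == -1) ->
  exists2 w, (w <= U D (k + r%:Z))%MS & v = w *m phi ^+ r.
Proof.
move=> hp vU v0 hr; set m : int := _ - 2 * k => hm.
set c : F := \prod_(i < r) (i.+1%:Z * (m - i%:Z))%:~R.
have c0 : c != 0.
  apply/prodf_neq0 => i _; rewrite rmorphM /= mulf_neq0 //.
    by apply: (int_pchar_neq0 hp); move: hr (ltn_ord i); clear; lia.
  by apply: (int_pchar_neq0 hp); move: hr hm (ltn_ord i); move: (m); clear; lia.
exists (c^-1 *: (v *m psi D ^+ r)); first by rewrite scalemx_sub ?U_psiX.
by rewrite -scalemxAl (psiX_phiX_hw _ vU v0) scalerA mulVf ?scale1r.
Qed.

(* The product of the x_b - x_a over the pairs (a, b) in zs: the polytabloid of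
   a filling with these columns, see polytabloidE. *)
Fixpoint pt zs : 'rV[F]_N :=
  if zs is z :: zs' then pt zs' *m (ins z.2 - ins z.1) else eset set0.

Fixpoint valid D zs :=
  if zs is z :: zs' then
    [&& z.1 \in D, z.2 \in D, z.1 != z.2 & valid (D :\ z.1 :\ z.2) zs']
  else true.

Lemma valid_mono D D' zs : D \subset D' -> valid D zs -> valid D' zs.
Proof.
elim: zs D D' => // z zs IH D D' h /= /and4P[h1 h2 -> h3].
by rewrite !(subsetP h) //= (IH _ _ _ h3) // !setSD.
Qed.

(** Provides the partner c of the removed letter [a], so that a polytabloid over [D :\ a] extends by
    the column (c, a). *)
Lemma valid_extra D zs : valid D zs -> (2 * size zs < #|D|)%N ->
  exists2 c, c \in D & valid (D :\ c) zs.
Proof.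
elim: zs D => [|[a b] zs IH] D /=.
  by move=> _; rewrite muln0 => /card_gt0P[c hc]; exists c.
case/and4P=> ha hb ab hv hc; case: (IH _ hv) => [|c].
  move: hc; rewrite (cardsD1 a D) ha (cardsD1 b (D :\ a)) !inE eq_sym ab hb /=.
  by move: #|_|; clear; lia.
rewrite !inE => /and3P[cb ca cD] h; exists c => //.
rewrite !inE ![_ == c]eq_sym ca ha cb hb ab /=; apply: valid_mono h.
by apply/subsetP => x; rewrite !inE => /and4P[-> -> -> ->].
Qed.

Lemma pt_U D zs : valid D zs -> (pt zs <= U D (size zs)%:Z)%MS.
Proof.
elim: zs D => [|[a b] zs IH] D /=; first by move=> _; rewrite eset_sub ?sub0set ?cards0.
case/and4P=> ha hb ab /IH h.
have {}h : (pt zs <= U D (size zs)%:Z)%MS.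
  apply: submx_trans h (U_mono _ _ _); apply/subsetP => x; rewrite !inE.
  by case/and3P.
have e : (size zs).+1%:Z = (size zs)%:Z + 1 by lia.
by rewrite mulmxBr addmx_sub ?eqmx_opp // e U_ins.
Qed.

Lemma pt_del0 D zs a : valid D zs -> a \notin D -> pt zs *m del a = 0.
Proof. by move=> h ha; apply: U_del0 ha (pt_U h). Qed.

Lemma pt_phi D zs : valid D zs -> pt zs *m phi = 0.
Proof.
elim: zs D => [|[a b] zs IH] D /=.
  by move=> _; apply: (U_eq0 (U_phi (@pt_U D [::] isT))); rewrite sub0r.
case/and4P=> ha hb ab h; rewrite mulmxBr mulmxBl.
rewrite !ins_phi_free ?(IH _ h) ?mul0mx ?subrr //;
  by apply: (pt_del0 h); rewrite !inE eqxx ?andbF.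
Qed.

(** Squares of letters vanish, hence (x_b - x_a) (x_a + x_b) = 0. *)
Lemma ins_psi D a b : a \in D -> b \in D -> a != b ->
  (ins b - ins a) *m psi D = psi (D :\ a :\ b) *m (ins b - ins a).
Proof.
move=> ha hb ab; rewrite /psi (big_setD1 a) //= (big_setD1 b) /=; last first.
  by rewrite !inE eq_sym ab.
rewrite addrA mulmxDr [X in X + _](_ : _ = 0) ?add0r.
  rewrite mulmx_sumr mulmx_suml; apply: eq_bigr => c _.
  by rewrite mulmxBl mulmxBr !(ins_ins _ c).
by rewrite mulmxDr !mulmxBl !insK subr0 sub0r ins_ins subrr.
Qed.

(** By [ins_psi] only the letters outside the pairs survive in [psi D]. There are fewer than r of
    them, and a product of r of them is zero. *)
Lemma pt_psi D zs r : valid D zs -> (#|D| < 2 * size zs + r)%N ->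
  pt zs *m psi D ^+ r = 0.
Proof.
elim: zs D => [|[a b] zs IH] D /=.
  move=> _ h; apply: (U_eq0 (U_psiX r (@pt_U D [::] isT))).
  by rewrite /= add0r; move: h; clear; lia.
case/and4P=> ha hb ab hv hc.
rewrite -mulmxA; have -> : (ins b - ins a) *m psi D ^+ r = psi (D :\ a :\ b) ^+ r *m (ins b - ins a).
  elim: (r) => [|s IHs]; first by rewrite mulmx1 mul1mx.
  by rewrite exprSr -mulmxE mulmxA IHs -mulmxA ins_psi // mulmxA mulmxE -exprSr.
rewrite mulmxA IH ?mul0mx //.
move: hc; rewrite (cardsD1 a D) ha (cardsD1 b (D :\ a)) !inE eq_sym ab hb /=.
by move: #|_|; clear; lia.
Qed.

Lemma phiDX_tr D r : (phiD D ^+ r)^T = psi D ^+ r.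
Proof.
elim: r => [|r IH]; first exact: trmx1.
by rewrite exprSr exprS -!mulmxE trmx_mul IH -tr_psi trmxK.
Qed.

Lemma pt_orth_im D zs w (r : nat) : valid D zs -> (#|D| < 2 * size zs + r)%N ->
  (w <= U D ((size zs)%:Z + r%:Z))%MS -> w *m phi ^+ r *m (pt zs)^T = 0.
Proof.
move=> hv hc hw; rewrite (phiX_phiD _ hw) -mulmxA -[phiD D ^+ r]trmxK -trmx_mul.
by rewrite phiDX_tr pt_psi // trmx0 mulmx0.
Qed.

Lemma mul_ins_tr v w a : v *m ins a *m w^T = v *m (w *m del a)^T.
Proof. by rewrite trmx_mul tr_del mulmxA. Qed.

Lemma mul_del_tr v w a : v *m del a *m w^T = v *m (w *m ins a)^T.
Proof. by rewrite trmx_mul tr_ins mulmxA. Qed.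

Lemma mul_psi_tr v w D : v *m psi D *m w^T = v *m (w *m phiD D)^T.
Proof. by rewrite trmx_mul -tr_psi trmxK mulmxA. Qed.

(** Multiplying by x_b - x_a and then applying its adjoint d_b - d_a doubles a vector free of a and
    b. *)
Lemma pt_norm D zs : valid D zs -> pt zs *m (pt zs)^T = (2 ^+ size zs)%:M.
Proof.
elim: zs D => [|[a b] zs IH] D /=.
  move=> _; apply/rowP => i; rewrite ord1 mxE (bigD1 (enum_rank set0)) //= big1 ?addr0.
    by rewrite !mxE !eqxx mulr1.
  by move=> j hj; rewrite !mxE (negPf hj) andbF mulr0.
case/and4P=> ha hb ab hv.
have da : pt zs *m del a = 0 by apply: (pt_del0 hv); rewrite !inE eqxx ?andbF.
have db : pt zs *m del b = 0 by apply: (pt_del0 hv); rewrite !inE eqxx ?andbF.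
have e : pt zs *m (ins b - ins a) *m (del b - del a) = 2 *: pt zs.
  rewrite mulmxBr mulmxBr !mulmxBl -!(mulmxA (pt zs)) !ins_del !mulmxBr !mulmx1.
  rewrite -(del_ins F ab) -(@del_ins F _ b a) 1?eq_sym // !mulmxA da db !mul0mx !subr0 sub0r opprK.
  by rewrite scaler_nat mulr2n.
have -> : (pt zs *m (ins b - ins a))^T = (del b - del a) *m (pt zs)^T.
  by rewrite trmx_mul linearB /= !tr_ins.
by rewrite mulmxA e -scalemxAl (IH _ hv) scale_scalar_mx -exprS.
Qed.

Lemma coeff_tr v B : v *m (eset B)^T = (coeff v B)%:M.
Proof.
apply/rowP => i; rewrite ord1 mxE (bigD1 (enum_rank B)) //= big1 ?addr0.
  by rewrite !mxE !eqxx mulr1 mulr1n.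
by move=> j hj; rewrite !mxE (negPf hj) andbF mulr0.
Qed.

Lemma U_set0 k v : (v <= U set0 k)%MS -> v = coeff v set0 *: eset set0.
Proof.
move=> /in_UP hv; apply: coeffP => B; rewrite coeffZ coeff_eset.
have [<-|hB] := eqVneq set0 B; first by rewrite mulr1.
rewrite mulr0; apply/eqP; apply: contraT => /hv.
by rewrite subset0 eq_sym (negPf hB).
Qed.

Lemma del_split D k a v : (v <= U D k)%MS -> v *m phi = 0 ->
  [/\ (v *m del a <= U (D :\ a) (k - 1))%MS, v *m del a *m phi = 0
    & v *m del a *m del a = 0].
Proof.
move=> vU v0; split; first exact: U_del.
  by rewrite -mulmxA del_phi mulmxA v0 mul0mx.
by rewrite -mulmxA delK mulmx0.
Qed.

(** * The kernel of phi in characteristic p *)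

Section Char.

Variables (p : nat) (charF : p \in [pchar F]).

Lemma phiX_pred : phi ^+ (p - 1) *m phi = 0.
Proof.
have p1 := prime_gt1 (pcharf_prime charF).
rewrite mulmxE -exprSr -[RHS](phiX_eq0 n charF); congr (_ ^+ _).
by move: p1; clear; lia.
Qed.

(** Since [del a] commutes with [phi] and undoes multiplication by x_a on vectors free of a, each
    vector of the image over [D :\ a] is the a-derivative of a vector of the image over [D]. *)
Lemma im_del D k a w : (w <= U (D :\ a) (k - 1 + (p - 1)%:Z))%MS -> a \in D ->
  [/\ (w *m ins a <= U D (k + (p - 1)%:Z))%MS,
      w *m ins a *m phi ^+ (p - 1) *m del a = w *m phi ^+ (p - 1)
    & w *m ins a *m phi ^+ (p - 1) *m phi = 0].
Proof.
move=> hw ha; split.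
- have -> : k + (p - 1)%:Z = k - 1 + (p - 1)%:Z + 1 by clear; lia.
  by apply: U_ins => //; apply: submx_trans hw (U_mono _ _ (subD1set _ _)).
- rewrite -mulmxA -del_phiX mulmxA; congr (_ *m _).
  rewrite -mulmxA ins_del mulmxBr mulmx1 mulmxA (U_del0 _ hw) ?mul0mx ?subr0 //.
  by rewrite !inE eqxx.
by rewrite -mulmxA phiX_pred mulmx0.
Qed.

Local Notation weight D k := (#|D|%:Z - 2 * k).

(** Induction on the ground set. The a-derivative [v1] of [v] inherits orthogonality and lies in the
    image over [D :\ a]; subtracting from [v] an element of the image with the same a-derivative
    eliminates a, and induction applies again. *)
Lemma ker_orth_im D k v : (v <= U D k)%MS -> v *m phi = 0 ->
  (0 <= weight D k <= p%:Z - 2 -> forall zs, valid D zs -> (size zs)%:Z = k ->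
     v *m (pt zs)^T = 0) ->
  exists2 w, (w <= U D (k + (p - 1)%:Z))%MS & v = w *m phi ^+ (p - 1).
Proof.
have p1 := prime_gt1 (pcharf_prime charF).
move: {2}#|D| (erefl #|D|) => d; elim: d D k v => [|d IH] D k v hD vU vphi vorth.
  move/eqP: hD; rewrite cards_eq0 => /eqP hD; subst D.
  have v0 : v = 0.
    have [k0|k0] := eqVneq k 0; last first.
      by apply: (U_eq0 vU); rewrite cards0; move: k0; clear; lia.
    have := vorth _ [::] isT (esym k0); rewrite cards0 k0 coeff_tr => h.
    rewrite (U_set0 vU); have /matrixP/(_ 0 0) : (coeff v set0)%:M = 0 :> 'M_1.
      by apply: h; move: p1; clear; lia.
    by rewrite !mxE eqxx mulr1n => ->; rewrite scale0r.
  by exists 0; rewrite ?sub0mx // mul0mx.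
have [a ha] : exists a, a \in D by apply/card_gt0P; rewrite hD.
set D' := D :\ a; have hD' : #|D'| = d by move: hD; rewrite (cardsD1 a D) ha => -[].
have D'D : D' \subset D := subD1set _ _.
have aD' : a \notin D' by rewrite !inE eqxx.
set m : int := weight D k.
(* Here m lies outside [0, p - 2] while m + 1 or m - 1 may lie inside, so no orthogonality is at
   hand for the smaller ground set. [hw_lift] with r = p - 1 replaces the induction. *)
have [m_special|m_gen] := boolP ((m == -1) || (m == p%:Z - 1)).
  by apply: (hw_lift charF vU vphi); rewrite -/m; move: p1 m_special; move: (m); clear; lia.
have IHk u : (u <= U D' k)%MS -> u *m phi = 0 ->
  (0 <= m <= p%:Z - 2 -> forall zs, valid D' zs -> (size zs)%:Z = k ->
     u *m (pt zs)^T = 0) ->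
  exists2 w, (w <= U D' (k + (p - 1)%:Z))%MS & u = w *m phi ^+ (p - 1).
  move=> uU u0 h; apply: IH => // hm; apply: h.
  by move: m_gen hm; rewrite /m hD hD'; clear; lia.
have [v1U v1phi v1a] := del_split a vU vphi; set v1 := v *m del a in v1U v1phi v1a.
have m1 : weight D' (k - 1) = m + 1 by rewrite /m hD hD'; clear; lia.
set v0 := v - v1 *m ins a.
have insV1 : (v1 *m ins a <= U D k)%MS.
  have -> : k = k - 1 + 1 by clear; lia.
  by apply: U_ins => //; apply: submx_trans v1U (U_mono _ _ D'D).
have v0a : v0 *m del a = 0.
  by rewrite mulmxBl -mulmxA ins_del mulmxBr mulmx1 mulmxA v1a mul0mx subr0 subrr.
have v0U : (v0 <= U D' k)%MS.
  by apply: U_D1 v0a; rewrite addmx_sub ?eqmx_opp.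
have v0phi : v0 *m phi = - v1.
  by rewrite mulmxBl vphi (ins_phi_free v1a) v1phi mul0mx !add0r.
have [w wU v1w] : exists2 w, (w <= U D' (k - 1 + (p - 1)%:Z))%MS
                           & v1 = w *m phi ^+ (p - 1).
  apply: IH => // hm zs hzs zsk; rewrite m1 in hm.
  have hm0 : 0 <= m <= p%:Z - 2 by move: hm m_gen; move: (m); clear; lia.
  have nz1 : (m + 1)%:~R != 0 :> F.
    by apply: (int_pchar_neq0 charF); move: hm hm0; move: (m); clear; lia.
  have nz2 : (m + 2)%:~R != 0 :> F.
    by apply: (int_pchar_neq0 charF); move: hm hm0; move: (m); clear; lia.
  have v1psi : v1 *m psi D' *m phi = (m + 1)%:~R *: v1.
    by rewrite (psi_phi_U v1U) v1phi mul0mx add0r m1.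
  (* v - v0' is the component of v generated by v1, of weight m + 1. *)
  pose v0' := v0 + (m + 1)%:~R^-1 *: (v1 *m psi D').
  have [|||w' w'U v0'w] := IHk v0'.
  - rewrite addmx_sub // scalemx_sub //.
    by have := U_psi v1U; rewrite subrK.
  - by rewrite mulmxDl v0phi -scalemxAl v1psi scalerA mulVf // scale1r addNr.
  - move=> _ ys hys ysk; have hysD := valid_mono D'D hys.
    rewrite mulmxDl mulmxBl (vorth hm0 _ hysD ysk) mul_ins_tr (pt_del0 hys) //.
    rewrite -scalemxAl mul_psi_tr -(phi_phiD (pt_U hys)) (pt_phi hys).
    by rewrite trmx0 !mulmx0 subr0 scaler0 addr0.
  have [|c hc hzc] := valid_extra hzs.
    by move: hm0 zsk; rewrite /m hD hD'; clear; lia.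
  have ca : c != a by move: hc; rewrite !inE => /andP[].
  have hcz : valid D ((c, a) :: zs).
    rewrite /= ha (subsetP D'D _ hc) ca /= -[D :\ c :\ a](_ : D' :\ c = _) //.
    by apply/setP => x; rewrite !inE andbCA.
  have sz : (size ((c, a) :: zs))%:Z = k by rewrite /= -addn1 PoszD zsk subrK.
  set e := pt zs.
  have eU : (e *m ins c <= U D' k)%MS.
    have -> : k = (size zs)%:Z + 1 by rewrite zsk subrK.
    exact: U_ins hc (pt_U hzs).
  have eca : v1 *m e^T = v *m (e *m ins c)^T.
    have := vorth hm0 _ hcz sz; rewrite /= mulmxBr linearB /= mulmxBr -mul_del_tr.
    by move/eqP; rewrite subr_eq0 => /eqP.
  have v0c : v0 *m (e *m ins c)^T = v1 *m e^T.
    rewrite mulmxBl -eca mul_ins_tr (U_del0 aD' eU) trmx0 mulmx0 subr0 //.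
  have v0'c : v0' *m (e *m ins c)^T = 0.
    have : v0' *m (pt ((c, a) :: zs))^T = 0.
      rewrite v0'w; apply: (pt_orth_im hcz).
        by move: hm0 sz p1; rewrite /m hD /=; clear; lia.
      by rewrite sz; apply: submx_trans w'U (U_mono _ _ D'D).
    rewrite /= mulmxBr linearB /= mulmxBr -mul_del_tr.
    have -> : v0' *m del a = 0.
      by rewrite v0'w -mulmxA -del_phiX mulmxA (U_del0 aD' w'U) mul0mx.
    by rewrite mul0mx sub0r => /eqP; rewrite oppr_eq0 => /eqP.
  have epc : v1 *m psi D' *m (e *m ins c)^T = v1 *m e^T.
    rewrite mul_psi_tr -(phi_phiD eU) ins_phi_free ?(pt_phi hzs) ?mul0mx ?add0r //.
    by apply: (pt_del0 hzc); rewrite !inE eqxx.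
  (* Both [v0] and [v1 *m psi D'] pair with e x_c to the value v1 . e, the latter because [phi]
     sends e x_c to e. Multiplying the pairing of [v0'] with e x_c, which is 0, by m + 1 gives (m +
     1) + 1 times this value. *)
  have : (m + 2)%:~R *: (v1 *m e^T) = 0.
    have -> : m + 2 = m + 1 + 1 by move: (m); clear; lia.
    rewrite rmorphD /= scalerDl scale1r -{1}v0c.
    have := congr1 (fun z : 'M[F]_1 => (m + 1)%:~R *: z) v0'c.
    by rewrite mulmxDl -scalemxAl epc scaler0 scalerDr scalerA mulfV // scale1r.
  by move/eqP; rewrite scaler_eq0 (negPf nz2) /= => /eqP.
have [xU xa xphi] := im_del wU ha.
set x := w *m ins a *m phi ^+ (p - 1) in xa xphi.
have xUk : (x <= U D k)%MS by have := U_phiX (p - 1) xU; rewrite addrK.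
have [|||w' w'U e] := IHk (v - x).
- by apply: U_D1; rewrite ?addmx_sub ?eqmx_opp // mulmxBl xa -v1w subrr.
- by rewrite mulmxBl vphi xphi subrr.
- move=> hm zs hzs zsk; have hzsD := valid_mono D'D hzs.
  rewrite mulmxBl (vorth hm _ hzsD zsk) sub0r; apply/eqP; rewrite oppr_eq0; apply/eqP.
  apply: (pt_orth_im hzsD); last by rewrite zsk.
  by move: hm zsk p1; rewrite /m hD; clear; lia.
exists (w' + w *m ins a).
  by rewrite addmx_sub //; apply: submx_trans w'U (U_mono _ _ D'D).
by rewrite mulmxDl -e -/x subrK.
Qed.

(** [M] is an arbitrary subspace because the induction applies the statement to the image under
    [del a] of a part of [M]; it again contains the image and the polytabloids over the smaller
    ground set. *)
Lemma ker_sub_pt_im D k v (M : 'M[F]_N) : (v <= U D k)%MS -> v *m phi = 0 ->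
  (forall w, (w <= U D (k + (p - 1)%:Z))%MS -> (w *m phi ^+ (p - 1) <= M)%MS) ->
  (0 <= weight D k <= p%:Z - 2 -> forall zs, valid D zs -> (size zs)%:Z = k ->
     (pt zs <= M)%MS) ->
  (v <= M)%MS.
Proof.
have p1 := prime_gt1 (pcharf_prime charF).
move: {2}#|D| (erefl #|D|) => d; elim: d D k v M => [|d IH] D k v M hD vU vphi imM ptM.
  move/eqP: hD; rewrite cards_eq0 => /eqP hD; subst D.
  have [k0|k0] := eqVneq k 0; last first.
    rewrite (_ : v = 0) ?sub0mx //.
    by apply: (U_eq0 vU); rewrite cards0; move: k0; clear; lia.
  rewrite (U_set0 vU) scalemx_sub //.
  by apply: (ptM _ [::]) => //; rewrite k0 cards0; move: p1; clear; lia.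
set m : int := weight D k in ptM.
(* Outside the range the orthogonality hypothesis of [ker_orth_im] is void. *)
have [hm|hm] := boolP (0 <= m <= p%:Z - 2); last first.
  have [|w wU ->] := ker_orth_im vU vphi; last exact: imM.
  by rewrite -/m (negPf hm).
have [a ha] : exists a, a \in D by apply/card_gt0P; rewrite hD.
set D' := D :\ a; have hD' : #|D'| = d by move: hD; rewrite (cardsD1 a D) ha => -[].
have D'D : D' \subset D := subD1set _ _.
have aD' : a \notin D' by rewrite !inE eqxx.
have [v1U v1phi v1a] := del_split a vU vphi; set v1 := v *m del a in v1U v1phi v1a.
(* Cutting [M] down to Ker phi in degree k allows an element of [K] with the same a-derivative as
   [v] to be subtracted from [v]: the difference is still in Ker phi and no longer involves a. *)
pose K := (M :&: kermx phi :&: U D k)%MS.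
have : (v1 <= K *m del a)%MS.
  apply: (IH D' (k - 1)) => //.
    move=> w wU; have [xU <- xphi] := im_del wU ha.
    apply: submxMr; rewrite !sub_capmx imM //=; apply/andP; split.
      exact/sub_kermxP.
    by have := U_phiX (p - 1) xU; rewrite addrK.
  move=> _ zs hzs zsk; have [|c hc hzc] := valid_extra hzs.
    by move: hm zsk; rewrite /m hD hD'; clear; lia.
  have ca : c != a by move: hc; rewrite !inE => /andP[].
  have hcz : valid D ((c, a) :: zs).
    rewrite /= ha (subsetP D'D _ hc) ca /= -[D :\ c :\ a](_ : D' :\ c = _) //.
    by apply/setP => x; rewrite !inE andbCA.
  have sz : (size ((c, a) :: zs))%:Z = k by rewrite /= -addn1 PoszD zsk subrK.
  have -> : pt zs = pt ((c, a) :: zs) *m del a.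
    rewrite /= mulmxBr mulmxBl -!(mulmxA (pt zs)) ins_del -(@del_ins F _ a c) 1?eq_sym //.
    by rewrite mulmxBr mulmx1 !mulmxA (pt_del0 hzs aD') !mul0mx !subr0.
  apply: submxMr; rewrite !sub_capmx ptM // -sz pt_U // andbT.
  exact/sub_kermxP/(pt_phi hcz).
case/submxP => y hy; set v2 := y *m K.
have : (v2 <= K)%MS := submxMl _ _.
rewrite !sub_capmx => /andP[/andP[v2M /sub_kermxP v2phi] v2U].
rewrite -[v](subrK v2) addmx_sub //; apply: (IH D' k) => //.
- by apply: U_D1; rewrite ?addmx_sub ?eqmx_opp // mulmxBl -mulmxA -hy subrr.
- by rewrite mulmxBl vphi v2phi subrr.
- by move=> w wU; apply: imM; apply: submx_trans wU (U_mono _ _ D'D).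
by move=> _ zs hzs zsk; apply: ptM => //; apply: valid_mono hzs.
Qed.

End Char.
End HighestWeight.

(** * Polytabloids and Specht modules *)

Section Polytabloids.

Variables (F : fieldType) (n : nat).
Local Notation N := #|{set 'I_n}|.
Local Notation phi := (phi_mx F n).
Local Notation eset := (eset F).
Local Notation U := (subset_span F).
Local Notation ins := (ins F).
Local Notation del := (del F).
Local Notation rG := (set_repr F n).
Local Notation pt := (pt F).
Implicit Types (a b c : 'I_n) (A B D : {set 'I_n}) (v w u : 'rV[F]_N).
Implicit Types (zs : seq ('I_n * 'I_n)).
Local Notation colgrp zs := (\prod_(x <- zs) <[tperm x.1 x.2]>)%g.

Lemma eset_perm A (s : {perm 'I_n}) : eset A *m rG s = eset (s @: A).
Proof. exact: eset_extend. Qed.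

Lemma colgrp_perm_on D zs s : valid D zs -> s \in colgrp zs -> perm_on D s.
Proof.
suff h : valid D zs -> colgrp zs \subset Sym D.
  by move=> /h /subsetP hs /hs; rewrite inE.
elim: zs D => [|[a b] zs IH] D /=; first by rewrite big_nil sub1G.
case/and4P=> ha hb ab /IH h; rewrite big_cons mul_subG //.
  rewrite cycle_subG inE; apply: subset_trans (tperm_on a b) _.
  by rewrite subUset !sub1set ha.
apply: subset_trans h _; apply/subsetP => s'; rewrite !inE => h.
exact: subset_trans h (subset_trans (subsetDl _ _) (subsetDl _ _)).
Qed.

Lemma perm_ins D s A c : perm_on D s -> A \subset D -> c \notin D ->
  eset (c |: A) *m rG s = eset A *m rG s *m ins c.
Proof.
move=> hs hA hc; have sc : s c = c by apply: out_perm hs hc.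
rewrite !eset_perm eset_ins ifN; first by rewrite imsetU1 sc.
apply: contra hc => /imsetP[x hx ->]; rewrite (perm_closed _ hs).
exact: (subsetP hA).
Qed.

(** With t the transposition of a and b and C the column group of [zs], that of (a, b) :: zs is the
    disjoint union of C and tC. As C fixes a and b, the two parts give multiplication by x_b and by
    -x_a. *)
Lemma colgrp_sum D zs : valid D zs ->
  \sum_(s in colgrp zs)
     (-1) ^+ odd_perm s *: (eset [set x in unzip2 zs] *m rG s) = pt zs.
Proof.
elim: zs D => [|[a b] zs IH] D /=.
  move=> _; rewrite big_nil (big_pred1 1%g) => [|s]; last by rewrite /= inE.
  have -> : [set x : 'I_n in [::]] = set0 by apply/setP => x; rewrite !inE.
  by rewrite odd_perm1 scale1r eset_perm imset0.
case/and4P=> ha hb ab hv; rewrite -(IH _ hv) mulmx_suml big_cons /=.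
set D' := D :\ a :\ b in hv *; set B := [set x in unzip2 zs]; set C := colgrp zs.
have aD' : a \notin D' by rewrite !inE eqxx andbF.
have bD' : b \notin D' by rewrite !inE eqxx.
have BD' : B \subset D'.
  apply/subsetP => x; rewrite inE => /mapP[z hz ->].
  elim: zs D' hv hz {IH B C aD' bD'} => //= y zs IH D' /and4P[_ h2 _ h4].
  rewrite inE => /orP[/eqP -> //|/(IH _ h4)]; rewrite !inE.
  by case/and3P.
have on_C s : s \in C -> perm_on D' s by apply: colgrp_perm_on.
pose t := tperm a b.
have t1 : t != 1%g.
  by apply/eqP => /permP/(_ a); rewrite tpermL perm1 => /eqP; rewrite eq_sym (negPf ab).
have ct : <[t]>%g = [set 1%g; t].
  apply: cycle2g; apply: nt_prime_order t1 => //.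
  by rewrite expgS expg1 tperm2.
have -> : [set x in b :: unzip2 zs] = b |: B by apply/setP => x; rewrite !inE.
rewrite -/t ct mulUg mul1g.
rewrite (eq_bigl (fun s => s \in [predU C & ([set t] * C)%g])) => [|s]; last by rewrite !inE.
rewrite bigU /=; last first.
  apply/pred0P => s /=; apply/negP => /andP[/on_C h1].
  case/mulsgP => ? s' /set1P-> /on_C h2 e; move: (out_perm h1 bD').
  by rewrite e permM tpermR (out_perm h2 aD') => /eqP; rewrite (negPf ab).
rewrite [X in _ + X](reindex_inj (mulgI t)) /= [X in _ + X](eq_bigl (mem C)) => [|s]; last first.
  by rewrite mem_lcoset mulKg.
rewrite -big_split; apply: eq_bigr => s sC /=.
have tB : eset (b |: B) *m rG t = eset (a |: B).
  rewrite eset_perm imsetU1 tpermR; congr (eset (_ |: _)).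
  rewrite -[RHS]imset_id; apply: eq_in_imset => x /(subsetP BD').
  by rewrite !inE => /and3P[h1 h2 _]; rewrite tpermD // eq_sym.
have -> : set_perm_mx F (t * s) = rG t *m rG s.
  exact: (repr_mxM rG (in_setT t) (in_setT s)).
rewrite -[set_perm_mx F s]/(rG s) mulmxA tB odd_mul_tperm ab.
rewrite !(perm_ins (on_C _ sC)) // -scalemxAl mulmxBr scalerBr; congr (_ + _).
by rewrite signr_addb expr1 mulN1r scaleNr.
Qed.

Lemma zip_valid D s1 s2 : (size s2 <= size s1)%N -> uniq (s1 ++ s2) ->
  {subset s1 ++ s2 <= D} -> valid D (zip s1 s2).
Proof.
elim: s1 s2 D => [|a s1 IH] [|b s2] D //= hs /andP[ha].
rewrite uniq_catC cons_uniq => /andP[hb hu] hD.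
have ab : a != b by apply: contraNneq ha => ->; rewrite mem_cat inE eqxx orbT.
rewrite ab !hD ?inE ?mem_cat ?inE ?eqxx ?orbT //=; apply: IH => // [|x hx].
  by rewrite uniq_catC.
rewrite !inE hD ?andbT; last first.
  by move: hx; rewrite !inE !mem_cat inE => /orP[] ->; rewrite !orbT.
apply/andP; split.
  by apply: contraNneq hb => <-; rewrite mem_cat orbC -mem_cat.
apply: contraNneq ha => <-.
by move: hx; rewrite !mem_cat inE => /orP[] ->; rewrite ?orbT.
Qed.

Lemma valid_uniq D zs : valid D zs ->
  uniq (unzip1 zs ++ unzip2 zs) /\ {subset unzip1 zs ++ unzip2 zs <= D}.
Proof.
elim: zs D => [|[a b] zs IH] D /=; first by [].
case/and4P=> ha hb ab /IH[hu hs].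
have h x : (x \in unzip1 zs ++ b :: unzip2 zs) = (x == b) || (x \in unzip1 zs ++ unzip2 zs).
  by rewrite !mem_cat inE orbCA.
have nL x : x \notin D :\ a :\ b -> x \notin unzip1 zs ++ unzip2 zs.
  by apply: contra; apply: hs.
split.
  rewrite h (negPf ab) nL ?inE ?eqxx ?andbF //= uniq_catC /= uniq_catC hu andbT.
  by rewrite mem_cat orbC -mem_cat nL // !inE eqxx.
move=> x; rewrite inE h => /or3P[/eqP->|/eqP->|/hs] //.
by rewrite !inE => /and3P[].
Qed.

Local Notation filling k := ((n - k).-tuple 'I_n * k.-tuple 'I_n)%type.

(** The bound on k makes the second row the shorter one, so that [zip] drops none of its entries. *)
Lemma polytabloidE k (t : filling k) : (2 * k <= n)%N -> uniq (t.1 ++ t.2) ->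
  polytabloid F t = pt (zip t.1 t.2).
Proof.
move=> hk ht; have hs : (size t.2 <= size t.1)%N.
  by rewrite !size_tuple; move: hk; clear; lia.
rewrite -(@colgrp_sum setT) ?unzip2_zip //.
by apply: zip_valid => // x _; rewrite inE.
Qed.

(** The letters outside the pairs are appended to the first row, where [zip] ignores them. *)
Lemma filling_of_valid k zs : valid [set: 'I_n] zs -> size zs = k ->
  exists2 t : filling k, uniq (t.1 ++ t.2) & zip t.1 t.2 = zs.
Proof.
move=> hv sk; have [hu _] := valid_uniq hv.
set s := unzip1 zs ++ unzip2 zs in hu.
pose r := [seq x <- enum 'I_n | x \notin s].
have hur : uniq (r ++ s).
  rewrite cat_uniq filter_uniq ?enum_uniq // hu andbT /=.
  by apply/hasPn => x hx; rewrite mem_filter /= hx.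
have sr : (size r + size s = n)%N.
  rewrite -size_cat -[RHS](size_enum_ord n); apply: perm_size.
  apply: uniq_perm; rewrite ?enum_uniq // => x.
  by rewrite mem_cat mem_filter mem_enum inE /=; case: (x \in s).
have s1 : size (unzip1 zs ++ r) == (n - k)%N.
  apply/eqP; move: sr; rewrite !size_cat !size_map sk; move: (size r); clear; lia.
have s2 : size (unzip2 zs) == k by rewrite size_map sk.
exists (Tuple s1, Tuple s2) => /=.
  by rewrite -catA (perm_uniq (permEl (perm_catCA _ _ _))).
rewrite -[unzip2 zs]cats0 zip_cat ?size_map // zip_unzip.
by case: (r) => [|? ?]; rewrite cats0.
Qed.

Lemma pt_specht k zs : (2 * k <= n)%N -> valid [set: 'I_n] zs -> size zs = k ->
  (pt zs <= specht_mx F n k)%MS.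
Proof.
move=> hk hv /(filling_of_valid hv)[t ht <-].
by rewrite -polytabloidE // (sumsmx_sup t) // genmxE.
Qed.

Lemma specht_subP k m (M : 'M[F]_(m, N)) : (2 * k <= n)%N ->
  (forall zs, valid [set: 'I_n] zs -> size zs = k -> (pt zs <= M)%MS) ->
  (specht_mx F n k <= M)%MS.
Proof.
move=> hk h; apply/sumsmx_subP => t ht; rewrite genmxE polytabloidE // h //.
  apply: zip_valid => [||x]; rewrite ?inE // !size_tuple.
  by move: hk; clear; lia.
by rewrite size_zip !size_tuple; move: hk; clear; lia.
Qed.

Lemma filling_transitive k (t t' : filling k) : (k <= n)%N ->
  uniq (t.1 ++ t.2) -> uniq (t'.1 ++ t'.2) -> exists g, filling_act g t = t'.
Proof.
move=> kn ht ht'; set s := t.1 ++ t.2 in ht; set s' := t'.1 ++ t'.2 in ht'.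
have ss : size s = n by rewrite size_cat !size_tuple subnK.
have ss' : size s' = n by rewrite size_cat !size_tuple subnK.
have mem_s x : x \in s.
  have := uniq_min_size ht (s2 := enum 'I_n).
  rewrite ss size_enum_ord leqnn => /(_ _ isT)[y _|_ ->]; exact: mem_enum.
have hinj : injective (fun x => nth x s' (index x s)).
  have idx x : (index x s < size s')%N by rewrite ss' -[X in (_ < X)%N]ss index_mem.
  move=> x y; rewrite (set_nth_default y x) // => /eqP.
  rewrite nth_uniq // => /eqP e.
  by rewrite -(nth_index x (mem_s x)) e nth_index.
exists (perm hinj).
have e : map (perm hinj) s = s'.
  rewrite (eq_map (permE hinj)).
  have es : size s = size s' := etrans ss (esym ss').
  case: (posnP (size s)) => [h|].
    by rewrite (size0nil h) (size0nil (etrans (esym es) h)).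
  case: {1}s => // x0 _ _; apply: (@eq_from_nth _ x0); first by rewrite size_map.
  move=> i; rewrite size_map => hi; rewrite (nth_map x0) // index_uniq //.
  by apply: set_nth_default; rewrite -es.
move: e; rewrite /s map_cat => /eqP.
rewrite eqseq_cat ?size_map ?size_tuple // => /andP[/eqP e1 /eqP e2].
case: (t') e1 e2 => t1 t2 /= e1 e2.
by congr pair; apply: val_inj.
Qed.

(** The symmetric group is transitive on fillings, hence on polytabloids. *)
Lemma specht_generated k zs (M : 'M[F]_N) : (2 * k <= n)%N ->
  valid [set: 'I_n] zs -> size zs = k -> mxmodule rG M -> (pt zs <= M)%MS ->
  (specht_mx F n k <= M)%MS.
Proof.
move=> hk hv sk modM hM; have [t ht e] := filling_of_valid hv sk.
apply/sumsmx_subP => t' ht'; rewrite genmxE.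
have [|g <-] := filling_transitive _ ht ht'; first by move: hk; clear; lia.
rewrite -polytabloid_act polytabloidE // e.
by apply: submx_trans (submxMr _ hM) _; apply: (mxmoduleP modM); rewrite inE.
Qed.

(** * Factorisation of the column antisymmetrizer through degree 0 *)

Fixpoint ptmx zs : 'M[F]_N :=
  if zs is z :: zs' then ptmx zs' *m (ins z.2 - ins z.1) else 1%:M.

Lemma ptE zs : pt zs = eset set0 *m ptmx zs.
Proof. by elim: zs => [|z zs IH] /=; rewrite ?mulmx1 // IH mulmxA. Qed.

(* 1 - (a b) annihilates every set that contains both or none of a and b; the
   factors ins _ *m del _ restrict to the sets avoiding an element. *)
Definition split_pair (z : 'I_n * 'I_n) : 'M[F]_N :=
  del z.2 *m (ins z.1 *m del z.1) - del z.1 *m (ins z.2 *m del z.2).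

Lemma one_sub_tperm a b : a != b ->
  1%:M - rG (tperm a b) = split_pair (a, b) *m (ins b - ins a).
Proof.
move=> ab; apply: eset_ext => A; rewrite mulmxBr mulmx1 eset_perm mulmxA.
rewrite /split_pair [eset A *m (_ - _)]mulmxBr !mulmxA !eset_del /=.
have e x y : x != y -> (if x \in A then eset (A :\ x) else 0) *m ins y *m del y =
    if (x \in A) && (y \notin A) then eset (A :\ x) else 0.
  move=> xy; case: (boolP (x \in A)) => hx; last by rewrite !mul0mx.
  rewrite eset_ins !inE eq_sym xy /=; case: (boolP (y \in A)) => hy /=.
    by rewrite mul0mx.
  by rewrite eset_del setU11 setU1K // !inE (negPf hy) andbF.
rewrite !e // 1?eq_sym //.
have fixA : (a \in A) = (b \in A) -> tperm a b @: A = A.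
  move=> h; apply/eqP; rewrite eqEcard card_imset ?leqnn ?andbT; last exact: perm_inj.
  apply/subsetP => _ /imsetP[x hx ->].
  by case: tpermP hx => [->|->|]; rewrite ?h // -?h.
case: (boolP (a \in A)) fixA => ha; case: (boolP (b \in A)) => hb /= fixA.
- by rewrite fixA // subrr subr0 mul0mx.
- rewrite sub0r mulNmx mulmxBr !eset_ins !inE eqxx (negPf hb) andbF /= setD1K // opprB.
  congr (_ - eset _); rewrite -{1}(setD1K ha) imsetU1 tpermL; congr (_ |: _).
  rewrite -[RHS]imset_id; apply: eq_in_imset => x; rewrite !inE => /andP[xa xA].
  by rewrite tpermD // 1?eq_sym //; apply: contraNneq hb => <-.
- rewrite subr0 mulmxBr !eset_ins !inE eqxx (negPf ha) andbF /= setD1K //.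
  congr (_ - eset _); rewrite -{1}(setD1K hb) imsetU1 tpermR; congr (_ |: _).
  rewrite -[RHS]imset_id; apply: eq_in_imset => x; rewrite !inE => /andP[xb xA].
  by rewrite tpermD // 1?eq_sym //; apply: contraNneq ha => <-.
by rewrite fixA // subrr subr0 mul0mx.
Qed.

Fixpoint split_mx zs : 'M[F]_N :=
  if zs is z :: zs' then split_pair z *m split_mx zs' else 1%:M.

(** The signed sum over the column group, as a product over the columns. *)
Fixpoint antisym_mx zs : 'M[F]_N :=
  if zs is z :: zs' then (1%:M - rG (tperm z.1 z.2)) *m antisym_mx zs' else 1%:M.

Lemma ins_split_mx D zs c : valid D zs -> c \notin D ->
  ins c *m split_mx zs = split_mx zs *m ins c.
Proof.
elim: zs D => [|[a b] zs IH] D; first by rewrite /= mulmx1 mul1mx.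
move=> /= /and4P[ha hb ab hv] hc.
have ca : a != c by apply: contraNneq hc => <-.
have cb : b != c by apply: contraNneq hc => <-.
have cP : ins c *m split_pair (a, b) = split_pair (a, b) *m ins c.
  rewrite mulmxBr mulmxBl !mulmxA -(del_ins F ca) -(del_ins F cb); congr (_ - _).
    by rewrite -(mulmxA _ (ins c)) ins_ins !mulmxA -(mulmxA _ (ins c)) -(del_ins F ca) mulmxA.
  by rewrite -(mulmxA _ (ins c)) ins_ins !mulmxA -(mulmxA _ (ins c)) -(del_ins F cb) mulmxA.
rewrite mulmxA cP -!mulmxA (IH _ hv) //.
by rewrite !inE (negPf hc) !andbF.
Qed.

(** The multiplications by x_b - x_a from [one_sub_tperm] can be moved to the end, past the
    splittings of the other pairs, which involve different letters. *)
Lemma antisym_mxE D zs : valid D zs -> antisym_mx zs = split_mx zs *m ptmx zs.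
Proof.
elim: zs D => [|[a b] zs IH] D; first by rewrite /= mulmx1.
move=> /= /and4P[ha hb ab hv]; rewrite (IH _ hv) one_sub_tperm //.
have comm c : c \notin D :\ a :\ b ->
    ins c *m (split_mx zs *m ptmx zs) = split_mx zs *m (ptmx zs *m ins c).
  move=> hc; rewrite mulmxA (ins_split_mx hv hc) -mulmxA; congr (_ *m _).
  elim: (zs) => [|z zs' IHz] /=; first by rewrite mulmx1 mul1mx.
  by rewrite mulmxA IHz -!mulmxA; congr (_ *m _); rewrite mulmxBl mulmxBr !(ins_ins _ c).
by rewrite -!mulmxA; congr (_ *m _); rewrite mulmxBl !comm ?mulmxBr ?inE ?eqxx ?andbF.
Qed.

Lemma U0 D v : (v <= U D 0)%MS -> v = coeff v set0 *: eset set0.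
Proof.
move=> /in_UP hv; apply: coeffP => B; rewrite coeffZ coeff_eset.
have [<-|hB] := eqVneq set0 B; first by rewrite mulr1.
rewrite mulr0; apply/eqP; apply: contraT => /hv /andP[_].
by rewrite eqz_nat cards_eq0 eq_sym (negPf hB).
Qed.

(** On vectors free of a and b, the transpose of [split_pair (a, b)] is multiplication by x_b -
    x_a. *)
Lemma split_mx_tr D zs : valid D zs -> eset set0 *m (split_mx zs)^T = pt zs.
Proof.
elim: zs D => [|[a b] zs IH] D; first by rewrite /= trmx1 mulmx1.
move=> /= /and4P[ha hb ab hv]; rewrite trmx_mul mulmxA (IH _ hv).
have da : pt zs *m del a = 0 by apply: (pt_del0 F hv); rewrite !inE eqxx ?andbF.
have db : pt zs *m del b = 0 by apply: (pt_del0 F hv); rewrite !inE eqxx ?andbF.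
rewrite linearB /= !trmx_mul !tr_ins !tr_del !mulmxBr !mulmxA.
by rewrite -!(mulmxA (pt zs)) !ins_del !mulmxBl !mul1mx !mulmxBr !mulmxA da db !mul0mx !subr0.
Qed.

Lemma split_mx_U zs k v : (v <= U setT k)%MS ->
  (v *m split_mx zs <= U setT (k - (size zs)%:Z))%MS.
Proof.
elim: zs k v => [|[a b] zs IH] k v vU; first by rewrite mulmx1 subr0.
have step x y : (v *m (del x *m (ins y *m del y)) <= U setT (k - 1))%MS.
  have dd c j w : (w <= U setT j)%MS -> (w *m del c <= U setT (j - 1))%MS.
    by move=> /(U_del c) h; apply: submx_trans h (U_mono _ _ (subsetT _)).
  rewrite !mulmxA -[k - 1](addrK 1).
  by apply/dd/U_ins; rewrite ?inE ?dd.
have -> : k - (size ((a, b) :: zs))%:Z = k - 1 - (size zs)%:Z by rewrite /=; clear; lia.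
by rewrite /= mulmxA; apply: IH; rewrite mulmxBr addmx_sub ?eqmx_opp.
Qed.

(** [split_mx zs] maps [v] to degree 0, that is to a multiple of the empty set. By [split_mx_tr] the
    coefficient is the pairing with the polytabloid, and [ptmx zs] turns the empty set into the
    polytabloid. *)
Lemma antisym_mx_pt zs v : valid setT zs -> (v <= U setT (size zs)%:Z)%MS ->
  v *m antisym_mx zs = (v *m (pt zs)^T) 0 0 *: pt zs.
Proof.
move=> hv vU; rewrite (antisym_mxE hv) mulmxA.
have := split_mx_U zs vU; rewrite subrr => /U0 e; rewrite {1}e -scalemxAl -ptE.
congr (_ *: _); rewrite -(split_mx_tr hv) trmx_mul trmxK mulmxA coeff_tr.
by rewrite mxE eqxx mulr1n.
Qed.

(* James' submodule theorem. *)
Lemma specht_or_orthogonal k (M : 'M[F]_N) : (2 * k <= n)%N ->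
  mxmodule rG M -> (M <= U setT k%:Z)%MS ->
  (specht_mx F n k <= M)%MS \/
  (forall zs, valid [set: 'I_n] zs -> size zs = k -> M *m (pt zs)^T = 0).
Proof.
move=> hk modM MU; have [hM|hM] := boolP (specht_mx F n k <= M)%MS; first by left.
right=> zs hv sk; apply/row_matrixP => i; rewrite row_mul row0.
set v := row i M; have vM : (v <= M)%MS := row_sub _ _.
apply/rowP => j; rewrite ord1 [RHS]mxE; apply/eqP; apply: contraR hM => c0.
apply: (specht_generated hk hv sk modM).
have e : v *m antisym_mx zs = (v *m (pt zs)^T) 0 0 *: pt zs.
  by apply: antisym_mx_pt => //; rewrite sk (submx_trans vM).
rewrite -[pt zs](scalerK c0) -e scalemx_sub //.
elim: (zs) (v) vM => [|z zs' IH] w wM /=; first by rewrite mulmx1.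
rewrite mulmxA IH // mulmxBr mulmx1 addmx_sub ?eqmx_opp //.
apply: submx_trans (submxMr _ wM) _; apply: (mxmoduleP modM); rewrite inE //.
Qed.

End Polytabloids.

(** * Exactness properties of phi *)

Section Exactness.

Variables (p : nat) (F : fieldType) (n : nat).
Hypotheses (charF : p \in [pchar F]) (n_gt0 : (0 < n)%N).
Local Notation N := #|{set 'I_n}|.
Local Notation phi := (phi_mx F n).
Local Notation omega := (omega_mx F n).
Local Notation ker := (ker_phi F n).
Local Notation im := (im_phi F n).
Local Notation rG := (set_repr F n).
Local Notation S := (specht_mx F n).
Local Notation pt := (pt F).
Implicit Types (v w u y : 'rV[F]_N) (k K : int).

Let p_gt1 : (1 < p)%N := prime_gt1 (pcharf_prime charF).

(** The bottom degrees of the strings that survive in homology. For small n the weight bounds alone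
    would admit negative k. *)
Definition in_range k : bool :=
  [&& p != 2%N, 0 <= k & 0 <= n%:Z - 2 * k <= p%:Z - 2].

Lemma ker_phiP k r v : reflect (v <= omega k /\ v *m phi ^+ r = 0)%MS (v <= ker k r)%MS.
Proof.
by rewrite sub_capmx; apply: (iffP andP) => -[h1 h2]; split=> //; apply/sub_kermxP.
Qed.

Lemma im_phiP k r v :
  reflect (exists2 w, (w <= omega k)%MS & v = w *m phi ^+ r) (v <= im k r)%MS.
Proof.
apply: (iffP idP) => [/submxP[y ->]|[w hw ->]]; last exact: submxMr.
by exists (y *m omega k); rewrite ?submxMl // mulmxA.
Qed.

Lemma omega_phi_exp k r v : (v <= omega k)%MS -> (v *m phi ^+ r <= omega (k - r%:Z))%MS.
Proof. by move=> h; apply: submx_trans (submxMr _ h) (omega_phiX F n k r). Qed.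

Lemma phiXD v r s : v *m phi ^+ r *m phi ^+ s = v *m phi ^+ (r + s).
Proof. by rewrite -mulmxA mulmxE -exprD. Qed.

Lemma phiXS v r : v *m phi ^+ r *m phi = v *m phi ^+ r.+1.
Proof. by rewrite -(addn1 r) -phiXD expr1. Qed.

Lemma phiX_leq v r s : v *m phi ^+ r = 0 -> (r <= s)%N -> v *m phi ^+ s = 0.
Proof. by move=> h rs; rewrite -(subnKC rs) -phiXD h mul0mx. Qed.

Lemma ker_exact k v : (v <= omega k)%MS -> v *m phi = 0 -> ~~ in_range k ->
  exists2 w, (w <= omega (k + (p - 1)%:Z))%MS & v = w *m phi ^+ (p - 1).
Proof.
move=> vU v0; rewrite omegaE in vU; rewrite /in_range; have [p2|p2 /=] := eqVneq p 2%N.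
  (* For p = 2 the commutator of [ins a] with [phi] is 1 - 2 [del a *m ins a], hence 1. *)
  move=> _; pose a := Ordinal n_gt0; exists (v *m ins F a).
    by rewrite omegaE p2; apply: U_ins; rewrite ?inE.
  rewrite p2 expr1 -mulmxA ins_phi mulmxDr mulmxA v0 mul0mx add0r ins_del.
  rewrite -addrA -opprD -mulr2n -scaler_nat.
  have /andP[_ /eqP->] : 2%N \in [pchar F] by rewrite -p2.
  by rewrite scale0r subr0 mulmx1.
have [k0|k0] /= := leP 0 k => hk; last first.
  by exists 0; rewrite ?sub0mx // mul0mx (U_eq0 vU) ?k0.
have [|w wU e] := ker_orth_im charF vU v0; last by exists w; rewrite ?omegaE.
by rewrite cardsT card_ord (negPf hk).
Qed.

Lemma ker_lift k r v : (v <= omega k)%MS -> v *m phi = 0 ->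
  r%:Z <= n%:Z - 2 * k <= p%:Z - 2 ->
  exists2 w, (w <= omega (k + r%:Z))%MS & v = w *m phi ^+ r.
Proof.
rewrite omegaE => vU v0 hr.
have [||w wU e] := hw_lift charF (r := r) vU v0; last by exists w; rewrite ?omegaE.
  by move: hr p_gt1; clear; lia.
by rewrite cardsT card_ord; move: hr p_gt1; clear; lia.
Qed.

Lemma ker_orth (k : nat) v : (v <= omega k%:Z)%MS -> v *m phi = 0 ->
  (forall zs, valid setT zs -> size zs = k -> v *m (pt zs)^T = 0) ->
  (v <= im (k%:Z + (p - 1)%:Z) (p - 1))%MS.
Proof.
rewrite omegaE => vU v0 h; apply/im_phiP.
have [|w wU e] := ker_orth_im charF vU v0; last by exists w; rewrite ?omegaE.
by move=> _ zs hzs [] sk; apply: h.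
Qed.

(** In the range, elements of Im phi^r with r > n - 2k are orthogonal to the polytabloids, so
    [ker_orth] applies. Elsewhere [ker_exact] does. *)
Lemma ker_im_long k r w : (w <= omega (k + r%:Z))%MS -> w *m phi ^+ r.+1 = 0 ->
  n%:Z - 2 * k < r%:Z ->
  exists2 w', (w' <= omega (k + (p - 1)%:Z))%MS & w *m phi ^+ r = w' *m phi ^+ (p - 1).
Proof.
move=> wU w0 hr; have vU := omega_phi_exp r wU; rewrite addrK in vU.
have v0 : w *m phi ^+ r *m phi = 0 by rewrite phiXS.
have [/and3P[_ k0 _]|] := boolP (in_range k); last exact: ker_exact.
case: k => // k in k0 vU wU hr *; apply/im_phiP/ker_orth => // zs hzs sk.
apply: (pt_orth_im hzs); first by rewrite cardsT card_ord; move: hr sk; clear; lia.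
by rewrite sk -omegaE.
Qed.

(* A vector of Ker phi in degree K - c, of weight in [0, p - 2], is the bottom of
   a string headed in degree n - K + c. This is K only for c = 2 * K - n; for all
   other c, if phi ^+ c maps a vector of degree K into Ker phi, then its image is
   divisible by phi ^+ c.+1. *)
Lemma ker_split K s b w : (b < p)%N ->
  (forall c, (s <= c < b)%N -> ~~ (in_range (n%:Z - K) && (c%:Z == 2 * K - n%:Z))) ->
  (w <= omega K)%MS -> w *m phi ^+ b = 0 ->
  exists u y, [/\ (u <= omega K)%MS, u *m phi ^+ s = 0, (y <= omega (K + 1))%MS
                & w = u + y *m phi].
Proof.
elim: b w => [|c IH] w hb hc wU w0.
  by exists 0, 0; rewrite mulmx1 in w0; split; rewrite ?sub0mx ?mul0mx ?w0 ?addr0.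
have [hs|hs] := ltnP c s.
  exists w, 0; split; rewrite ?sub0mx ?mul0mx ?addr0 //.
  exact: phiX_leq hs.
(* For such a y the vector w - y phi is already killed by phi^c, and induction splits it. *)
suff [y yU e] : exists2 y, (y <= omega (K + 1))%MS & w *m phi ^+ c = y *m phi ^+ c.+1.
  have [||||u [y' [uU u0 y'U e']]] := IH (w - y *m phi).
  - by move: hb; clear; lia.
  - by move=> d hd; apply: hc; move: hd; clear; lia.
  - rewrite addmx_sub ?eqmx_opp //.
    by have := omega_phi_exp 1 yU; rewrite expr1 addrK.
  - by rewrite mulmxBl e exprS -mulmxE mulmxA subrr.
  exists u, (y' + y); split=> //; first by rewrite addmx_sub.
  by rewrite mulmxDl addrA -e' subrK.
have xU := omega_phi_exp c wU.
have x0 : w *m phi ^+ c *m phi = 0 by rewrite phiXS.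
have long : (exists2 w', (w' <= omega (K - c%:Z + (p - 1)%:Z))%MS
      & w *m phi ^+ c = w' *m phi ^+ (p - 1)) ->
    exists2 y, (y <= omega (K + 1))%MS & w *m phi ^+ c = y *m phi ^+ c.+1.
  case=> w' w'U ->; exists (w' *m phi ^+ (p - 1 - c.+1)).
    have := omega_phi_exp (p - 1 - c.+1) w'U.
    by have -> : K - c%:Z + (p - 1)%:Z - (p - 1 - c.+1)%:Z = K + 1
      by move: hb; clear; lia.
  by rewrite phiXD subnK //; move: hb; clear; lia.
have [R|R] := boolP (in_range (K - c%:Z)); last exact/long/ker_exact.
have hcm := hc c; rewrite hs ltnSn in hcm; have {}hcm := hcm isT.
case/and3P: (R) => p2 k0 hm.
(* The weight in degree K - c is 2c - (2K - n). It is less than c in the first case; in the second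
   it is at least c + 1, which leaves room for lifting by c + 1 steps; equality is excluded by
   hypothesis. *)
have [h|h|h] := ltrgtP c%:Z (2 * K - n%:Z).
- apply: long; apply: ker_im_long => //; first by rewrite subrK.
  by move: h; clear; lia.
- have [|y yU e] := @ker_lift (K - c%:Z) c.+1 _ xU x0.
    by move: h hm; clear; lia.
  exists y => //; have <- : K - c%:Z + c.+1%:Z = K + 1 by clear; lia.
  by [].
move: hcm; rewrite h eqxx andbT.
have -> : n%:Z - K = K - c%:Z by rewrite h; clear; lia.
by rewrite R.
Qed.

Lemma specht_sub_ker (k : nat) : (2 * k <= n)%N -> (S k <= ker k%:Z 1)%MS.
Proof.
move=> hk; apply: specht_subP => // zs hv sk; apply/ker_phiP; split.
  by rewrite omegaE -sk pt_U.
by rewrite expr1 (pt_phi F hv).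
Qed.

Lemma specht_sub_omega (k : nat) : (2 * k <= n)%N -> (S k <= omega k%:Z)%MS.
Proof. by move=> hk; apply: submx_trans (specht_sub_ker hk) (capmxSl _ _). Qed.

Lemma im_orth_pt (k r : nat) v zs : valid setT zs -> size zs = k ->
  n%:Z - 2 * k%:Z < r%:Z -> (v <= im (k%:Z + r%:Z) r)%MS -> v *m (pt zs)^T = 0.
Proof.
move=> hv sk hr /im_phiP[w wU ->]; apply: (pt_orth_im hv); last by rewrite sk -omegaE.
by rewrite cardsT card_ord; move: hr sk; clear; lia.
Qed.

Lemma valid_exists (D : {set 'I_n}) (k : nat) : (2 * k <= #|D|)%N ->
  exists2 zs, valid D zs & size zs = k.
Proof.
elim: k D => [|k IH] D hD; first by exists [::].
have [a ha] : exists a, a \in D by apply/card_gt0P; move: hD; move: #|D|; clear; lia.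
have hDa : (2 * k < #|D :\ a|)%N.
  by move: hD; rewrite (cardsD1 a D) ha; move: #|_|; clear; lia.
have [b hb] : exists b, b \in D :\ a by apply/card_gt0P; apply: leq_trans hDa.
have [|zs hv sk] := IH (D :\ a :\ b).
  by move: hDa; rewrite (cardsD1 b (D :\ a)) hb; move: #|_|; clear; lia.
exists ((a, b) :: zs); rewrite /= ?sk // ha hv.
by move: hb; rewrite !inE eq_sym => /andP[-> ->].
Qed.

Section Range.

Variables (k : nat) (k_range : in_range k%:Z).

Let k_le : (2 * k <= n)%N.
Proof. by case/and3P: k_range => _ _; clear; lia. Qed.

Let imk := im (k%:Z + (p - 1)%:Z) (p - 1).

(** A polytabloid pairs with itself to 2^k, nonzero as p is odd, but is orthogonal to Im phi^(p-1)
    because n - 2k < p - 1. *)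
Lemma specht_not_sub_im : ~~ (S k <= imk)%MS.
Proof.
have [|zs hv sk] := @valid_exists setT k; first by rewrite cardsT card_ord.
apply/negP => /(submx_trans (pt_specht F k_le hv sk)) /(im_orth_pt hv sk) h.
have : pt zs *m (pt zs)^T = 0.
  by apply: h; case/and3P: k_range => _ _; move: p_gt1; clear; lia.
rewrite (pt_norm F hv) => /matrixP/(_ 0 0)/eqP.
rewrite !mxE eqxx mulr1n expf_eq0 => /andP[_].
rewrite -(dvdn_pcharf charF) dvdn_prime2 ?(pcharf_prime charF) //.
by case/and3P: k_range => /negPf->.
Qed.

(** The intersection of S with Im phi^(p-1) is the unique maximal submodule: it is proper, and a
    proper submodule is orthogonal to the polytabloids by [specht_or_orthogonal], hence in the image
    by [ker_orth]. *)
Lemma specht_radical v (modS : mxmodule rG (S k)) :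
  (v <= radical modS)%MS <-> (v <= S k)%MS /\ (v <= imk)%MS.
Proof.
have Sker := specht_sub_ker k_le.
have modR0 : mxmodule rG (S k :&: imk)%MS.
  by apply: capmx_module => //; apply: im_phi_module.
have R0_lt : (S k :&: imk < S k)%MS.
  rewrite ltmxE capmxSl /=; apply: contra specht_not_sub_im => h.
  exact: submx_trans h (capmxSr _ _).
have S_or (M : 'M_N) : mxmodule rG M -> (M < S k)%MS -> (M <= S k :&: imk)%MS.
  move=> modM; rewrite ltmxE => /andP[MS /negP nSM].
  have MU : (M <= subset_span F setT k%:Z)%MS.
    by rewrite -omegaE (submx_trans MS) ?specht_sub_omega.
  case: (specht_or_orthogonal k_le modM MU) => [/nSM//|horth].
  rewrite sub_capmx MS /=; apply/row_subP => i.
  have [|hU h0] := ker_phiP k%:Z 1 (row i M) _.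
    by apply: submx_trans Sker; apply: submx_trans MS; apply: row_sub.
  apply: ker_orth => // zs hv sk.
  by rewrite -row_mul (horth zs) // row0.
case: (radicalP modS) => _ hrad; split.
  move/hrad => [h1 h2]; split=> //; apply: submx_trans (capmxSr (S k) _).
  apply: h2 => //; split=> // W [modW h3 h4].
  by move: h3; rewrite ltmxE S_or // andbF.
move=> [h1 h2]; apply/hrad; split=> // M modM [MS maxM].
have R0v : (v <= S k :&: imk)%MS by rewrite sub_capmx h1.
apply: submx_trans R0v _; apply/negPn/negP => nR0M.
by case: (maxM (S k :&: imk)%MS); split; rewrite // ltmxE S_or.
Qed.

Lemma ker_sub_specht_im : (ker k%:Z 1 <= S k + imk)%MS.
Proof.
apply/rV_subP => v /ker_phiP[]; rewrite omegaE expr1 => vU v0.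
apply: (ker_sub_pt_im charF vU v0) => [w wU|_ zs hv [] sk].
  apply: submx_trans (addsmxSr _ _); apply/im_phiP; exists w => //.
  by rewrite omegaE.
exact: submx_trans (pt_specht F k_le hv sk) (addsmxSl _ _).
Qed.

End Range.

End Exactness.

(** * Maps between subquotients and between strings *)

Section ModuleMaps.

Variables (F : fieldType) (gT : finGroupType) (G : {group gT}).
Implicit Types L M P : module F G.

Lemma mod_iso_comp L M P (f : 'M_(mdim L, mdim M)) (g : 'M_(mdim M, mdim P)) :
  mod_iso_map f -> mod_iso_map g -> mod_iso_map (f *m g).
Proof.
case=> hf ff lf [hg fg lg]; split.
- by move=> x Gx; rewrite mulmxA hf // -[LHS]mulmxA hg // mulmxA.
- by rewrite /row_free mxrankMfree.
rewrite /row_full mxrankMfree // (eqP lf).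
by rewrite -(eqP fg) (eqP lg).
Qed.

Lemma mod_iso_inv M P (f : 'M_(mdim M, mdim P)) :
  mod_iso_map f -> mod_iso_map (pinvmx f : 'M_(mdim P, mdim M)).
Proof.
case=> hf ff lf; split.
- move=> x Gx; transitivity (pinvmx f *m (f *m mrepr P x) *m pinvmx f).
    by rewrite mulmxA mulVpmx // mul1mx.
  by rewrite -hf // -!mulmxA mulmxVp // mulmx1.
- by apply/row_freeP; exists f; rewrite mulVpmx.
by apply/row_fullP; exists f; rewrite mulmxVp.
Qed.

Lemma mod_iso_cancelr L M P (f : 'M_(mdim L, mdim M)) (g : 'M_(mdim M, mdim P)) :
  mod_iso_map g -> mod_iso_map (f *m g) -> mod_iso_map f.
Proof.
move=> hg /mod_iso_comp /(_ (mod_iso_inv hg)).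
by case: hg => _ fg _; rewrite -mulmxA mulmxVp // mulmx1.
Qed.

Lemma mod_iso1 M : mod_iso_map (1%:M : 'M_(mdim M, mdim M)).
Proof.
by split; rewrite ?row_free_unit ?row_full_unit ?unitmx1 // => x Gx; rewrite mulmx1 mul1mx.
Qed.

Lemma mod_iso_dim M P (f : 'M_(mdim M, mdim P)) : mod_iso_map f -> mdim M = mdim P.
Proof. by case=> _ /eqP h1 /eqP h2; apply: etrans h2; apply: esym h1. Qed.

Lemma mod_iso_isom M P (f : 'M_(mdim M, mdim P)) : mod_iso_map f -> mod_isom M P.
Proof. by move=> h; have e := mod_iso_dim h; case: h => hf ff _; exists f. Qed.

Lemma mod_iso0 M P (f : 'M_(mdim M, mdim P)) :
  mdim M = 0%N -> mdim P = 0%N -> mod_iso_map f.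
Proof.
move=> hM hP.
have r0 : \rank f = 0%N.
  by apply/eqP; rewrite -leqn0 (leq_trans (rank_leq_row f)) // hM.
split.
- by move=> x _; apply/matrixP => i; exfalso; move: i; rewrite hM => -[].
- by rewrite /row_free r0 hM.
by rewrite /row_full r0 hP.
Qed.

End ModuleMaps.

Section SubquotientMaps.

Variables (F : fieldType) (gT : finGroupType) (G : {group gT}) (m : nat).
Variable rG : mx_representation F G m.
Implicit Types X Y Z : subquotient rG.

Lemma sq_dim_eq0 X : mdim (sq_mod X) = 0%N <-> (sq_num X <= sq_den X)%MS.
Proof.
rewrite /= genmxE; split=> [/eqP|].
  by rewrite mxrank_eq0 in_factmod_eq0.
by rewrite -in_factmod_eq0 => /eqP->; rewrite mxrank0.
Qed.

Lemma sq_proj_inj0 X r (v : 'M_(r, m)) :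
  (v <= sq_num X + sq_den X)%MS -> sq_proj X v = 0 -> (v <= sq_den X)%MS.
Proof.
move=> hv h0; have := sq_projK hv; rewrite h0.
have -> : @sq_lift _ _ _ _ _ X r 0 = 0.
  by rewrite /sq_lift /val_submod /val_factmod /= !mulmxA -!mulmxA; apply: mul0mx.
by rewrite sub0r eqmx_opp.
Qed.

Lemma sq_map_row_free f X Y : sq_compat f X Y ->
  (forall v : 'rV_m, (v <= sq_num X + sq_den X)%MS -> (v *m f <= sq_den Y)%MS ->
     (v <= sq_den X)%MS) ->
  row_free (sq_map f X Y).
Proof.
move=> cf hf; apply/inj_row_free => w.
have hw := @sq_lift_sub _ _ _ _ _ X _ w; case: (cf) => _ hn hd.
rewrite -(@sq_liftK _ _ _ _ _ X _ w) (sq_mapE cf) // => h.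
apply/sq_proj_eq0/hf => //; apply: sq_proj_inj0 h.
by apply: submx_trans (submxMr f hw) _; rewrite addsmxMr addsmxS.
Qed.

Lemma sq_map_row_full f X Y : sq_compat f X Y ->
  (sq_num Y <= sq_num X *m f + sq_den Y)%MS -> row_full (sq_map f X Y).
Proof.
move=> cf hf; rewrite -sub1mx -(@sq_liftK _ _ _ _ _ Y _ 1%:M).
have : (@sq_lift _ _ _ _ _ Y _ 1%:M <= sq_num X *m f + sq_den Y)%MS.
  apply: submx_trans (sq_lift_sub _) _; rewrite addsmx_sub hf /=; exact: addsmxSr.
case/sub_addsmxP => -[u v] /= ->.
rewrite sq_projE mulmxDl -!sq_projE (sq_proj_eq0 (submxMl v _)) addr0 mulmxA.
by rewrite -(sq_mapE cf) ?submxMl // (submx_trans (submxMl _ _)) ?addsmxSl.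
Qed.

Lemma sq_map_iso f X Y : sq_compat f X Y -> (sq_den X <= sq_num X)%MS ->
  (forall v : 'rV_m, (v <= sq_num X)%MS -> (v *m f <= sq_den Y)%MS ->
     (v <= sq_den X)%MS) ->
  (forall v : 'rV_m, (v <= sq_num Y)%MS -> exists2 u : 'rV_m,
     (u <= sq_num X)%MS & (v - u *m f <= sq_den Y)%MS) ->
  mod_iso_map (sq_map f X Y).
Proof.
move=> cf hX h1 h2; split; first exact: sq_map_hom.
  apply: sq_map_row_free => // v hv; apply: h1; apply: submx_trans hv _.
  by rewrite addsmx_sub submx_refl.
apply: sq_map_row_full => //; apply/rV_subP => v /h2[u hu hv].
by rewrite -[v](subrK (u *m f)) addrC addmx_sub_adds ?submxMr.
Qed.

Lemma sq_map_comp f g X Y Z : sq_compat f X Y -> sq_compat g Y Z ->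
  sq_map f X Y *m sq_map g Y Z = sq_map (f *m g) X Z.
Proof.
case=> _ hn hd cg; rewrite {1}/sq_map (sq_mapE cg) /sq_map ?mulmxA //.
apply: submx_trans (submxMr f (sq_lift_sub _)) _.
by rewrite addsmxMr addsmxS.
Qed.

(* Every matrix between subquotients is induced by a matrix of the ambient
   space; this avoids families of matrices with dependent dimensions. *)
Definition sq_ambient X Y (g : 'M_(mdim (sq_mod X), mdim (sq_mod Y))) : 'M[F]_m :=
  sq_proj X 1%:M *m g *m @sq_lift _ _ _ _ _ Y _ 1%:M.

Lemma sq_map_ambient X Y g : sq_map (@sq_ambient X Y g) X Y = g.
Proof.
have e Z : @sq_lift _ _ _ _ _ Z _ 1%:M *m sq_proj Z 1%:M = 1%:M.
  by rewrite -sq_projE sq_liftK.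
rewrite /sq_map sq_projE /sq_ambient; move: (e X) (e Y).
move: (sq_proj X _) (sq_proj Y _) (@sq_lift _ _ _ _ _ X _ _) (@sq_lift _ _ _ _ _ Y _ _).
by move=> pX pY lX lY eX eY; rewrite !mulmxA eX mul1mx -mulmxA eY mulmx1.
Qed.

Lemma sq_window_dim0 lo hi (X : int -> subquotient rG) i :
  ~~ (lo <= i <= hi) -> mdim (sq_mod (sq_window lo hi X i)) = 0%N.
Proof. by rewrite /sq_window => /negPf->; apply: mdim_sq0. Qed.

(** The windows may differ as long as the terms outside their common part vanish. This compares the
    homology, with its p - 1 places, to a row of n - 2k + 1 terms. *)
Lemma string_isom lo hi lo' hi' (X Y : int -> subquotient rG) f f'
    (g : forall i, 'M_(mdim (sq_mod (X i)), mdim (sq_mod (Y i))))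
    (hf : forall i, lo < i <= hi -> sq_compat f (X i) (X (i - 1)))
    (hf' : forall i, lo' < i <= hi' -> sq_compat f' (Y i) (Y (i - 1))) :
  (forall i, lo <= i <= hi -> lo' <= i <= hi' -> mod_iso_map (g i)) ->
  (forall i, lo < i <= hi -> lo' < i <= hi' ->
     sq_map f (X i) (X (i - 1)) *m g (i - 1) = g i *m sq_map f' (Y i) (Y (i - 1))) ->
  (forall i, lo <= i <= hi -> ~~ (lo' <= i <= hi') -> mdim (sq_mod (X i)) = 0%N) ->
  (forall i, lo' <= i <= hi' -> ~~ (lo <= i <= hi) -> mdim (sq_mod (Y i)) = 0%N) ->
  gcomplex_isom (string hf) (string hf').
Proof.
move=> giso gcomm X0 Y0.
pose wX := sq_window lo hi X; pose wY := sq_window lo' hi' Y.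
have WX i : lo <= i <= hi -> wX i = X i by rewrite /wX /sq_window => ->.
have WY i : lo' <= i <= hi' -> wY i = Y i by rewrite /wY /sq_window => ->.
have dimX i : ~~ (lo' <= i <= hi') -> mdim (sq_mod (wX i)) = 0%N.
  move=> hi'0; case hi0: (lo <= i <= hi); last by rewrite sq_window_dim0 ?hi0.
  by rewrite WX // X0.
have dimY i : ~~ (lo <= i <= hi) -> mdim (sq_mod (wY i)) = 0%N.
  move=> hi'0; case hi0: (lo' <= i <= hi'); last by rewrite sq_window_dim0 ?hi0.
  by rewrite WY // Y0.
(* The type of [g i] refers to X i and Y i, not to the windows. An ambient matrix induces a map
   between either kind of terms. *)
have [h hE] : exists h : int -> 'M[F]_m, forall i, sq_map (h i) (X i) (Y i) = g i.
  by exists (fun i => sq_ambient (g i)) => i; apply: sq_map_ambient.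
exists (fun i => sq_map (h i) (wX i) (wY i)) => i; split.
  have [hi0|hi0] := boolP (lo <= i <= hi); last first.
    by apply: mod_iso0; [exact: sq_window_dim0 | exact: dimY].
  have [hi1|hi1] := boolP (lo' <= i <= hi'); last first.
    by apply: mod_iso0; [exact: dimX | exact: sq_window_dim0].
  change (mod_iso_map (sq_map (h i) (wX i) (wY i))).
  by rewrite WX // WY // hE; apply: giso.
have empty_row (a b : nat) (A B : 'M[F]_(a, b)) : a = 0%N -> A = B.
  by move=> a0; apply/matrixP => x; exfalso; move: x; rewrite a0 => -[].
have empty_col (a b : nat) (A B : 'M[F]_(a, b)) : b = 0%N -> A = B.
  by move=> b0; apply/matrixP => x y; exfalso; move: y; rewrite b0 => -[].
have [hi0|hi0] := boolP (lo <= i <= hi); last first.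
  by apply: empty_row; apply: sq_window_dim0.
have [hi1|hi1] := boolP (lo' <= i <= hi'); last by apply: empty_row; apply: dimX.
have [hi2|hi2] := boolP (lo <= i - 1 <= hi); last by apply: empty_col; apply: dimY.
have [hi3|hi3] := boolP (lo' <= i - 1 <= hi'); last first.
  by apply: empty_col; apply: sq_window_dim0.
change (sq_map f (wX i) (wX (i - 1)) *m sq_map (h (i - 1)) (wX (i - 1)) (wY (i - 1))
  = sq_map (h i) (wX i) (wY i) *m sq_map f' (wY i) (wY (i - 1))).
rewrite !WX // !WY // !hE; apply: gcomm.
  by move: hi0 hi2; clear; lia.
by move: hi1 hi3; clear; lia.
Qed.

Lemma string_arrows_iso lo hi (X : int -> subquotient rG) f
    (hf : forall i, lo < i <= hi -> sq_compat f (X i) (X (i - 1))) :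
  (forall i, lo < i <= hi -> mod_iso_map (sq_map f (X i) (X (i - 1)))) ->
  arrows_iso lo hi (string hf).
Proof.
move=> h i hi0; have := h i hi0.
have W j : lo <= j <= hi -> sq_window lo hi X j = X j by rewrite /sq_window => ->.
rewrite /= !W //; move: hi0; clear; lia.
Qed.

Lemma string_nonvanishing lo hi (X : int -> subquotient rG) f
    (hf : forall i, lo < i <= hi -> sq_compat f (X i) (X (i - 1))) :
  nonvanishing (string hf) <->
  exists2 i, lo <= i <= hi & ~~ (sq_num (X i) <= sq_den (X i))%MS.
Proof.
split=> [[i]|[i hi0 hX]].
  move=> hX; have [h|h] := boolP (lo <= i <= hi); last first.
    by case/eqP: hX; apply: sq_window_dim0.
  exists i => //; apply: contraNN hX => /sq_dim_eq0 h0; apply/eqP.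
  by change (mdim (sq_mod (sq_window lo hi X i)) = 0%N); rewrite /sq_window h.
exists i; change (mdim (sq_mod (sq_window lo hi X i)) != 0%N).
by rewrite /sq_window hi0; apply: contraNN hX => /eqP /sq_dim_eq0.
Qed.

End SubquotientMaps.

(** * Slash and backslash homology *)

Section Homology.

Variables (p : nat) (F : fieldType) (n : nat).
Hypotheses (charF : p \in [pchar F]) (n_gt0 : (0 < n)%N).
Local Notation N := #|{set 'I_n}|.
Local Notation phi := (phi_mx F n).
Local Notation omega := (omega_mx F n).
Local Notation ker := (ker_phi F n).
Local Notation im := (im_phi F n).
Local Notation rG := (set_repr F n).
Local Notation S := (specht_mx F n).
Local Notation in_range := (in_range p n).
Local Notation slash := (slash_sq F n p).
Local Notation backslash := (backslash_sq F n p).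
Local Notation D := (D_sq F n).
Implicit Types (v w u y : 'rV[F]_N) (k K : int) (a : nat).

Let p_gt1 : (1 < p)%N := prime_gt1 (pcharf_prime charF).

Lemma ker_phi0 k : ker k 0 = 0.
Proof.
apply/eqP; rewrite -submx0; apply/rV_subP => v /ker_phiP[_].
by rewrite expr0 mulmx1 => ->; apply: sub0mx.
Qed.

(** If v phi^a = w phi^(p-1), then v and w phi^(p-a-1) differ by an element of Ker phi^a. *)
Lemma slash_num_sub_den k a : (a <= p - 2)%N ->
  ~~ in_range k || (n%:Z - 2 * k < a%:Z) ->
  (sq_num (slash (k + a%:Z) a) <= sq_den (slash (k + a%:Z) a))%MS.
Proof.
move=> ap hk; apply/rV_subP => v /ker_phiP[vU v0].
have [w wU e] : exists2 w, (w <= omega (k + (p - 1)%:Z))%MS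
                         & v *m phi ^+ a = w *m phi ^+ (p - 1).
  case/orP: hk => hk; last exact: ker_im_long.
  apply: ker_exact; rewrite ?phiXS //.
  by have := omega_phi_exp a vU; rewrite addrK.
set x := w *m phi ^+ (p - a - 1).
have xa : x *m phi ^+ a = w *m phi ^+ (p - 1).
  by rewrite phiXD; congr (_ *m _ ^+ _); move: ap p_gt1; clear; lia.
have eK : k + a%:Z + (p - a - 1)%:Z = k + (p - 1)%:Z.
  by move: ap p_gt1; clear; lia.
rewrite -[v](subrK x) addrC; apply: addmx_sub_adds.
  by apply/im_phiP; exists w; rewrite ?eK.
apply/ker_phiP; split; last by rewrite mulmxBl e xa subrr.
rewrite addmx_sub ?eqmx_opp //.
by have := omega_phi_exp (p - a - 1) wU; rewrite -eK addrK.
Qed.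

Lemma slash_compatX k a : (a <= p - 2)%N ->
  sq_compat (phi ^+ a) (slash (k + a%:Z) a) (slash k 0).
Proof.
move=> ap; split; first exact: phiX_centgmx.
  apply/rV_subP => _ /submxP[y ->]; rewrite mulmxA.
  have /ker_phiP[vU v0] := submxMl y (ker (k + a%:Z) a.+1).
  apply/ker_phiP; rewrite phiXD addn1 v0; split=> //.
  by have := omega_phi_exp a vU; rewrite addrK.
rewrite addsmxMr addsmx_sub; apply/andP; split.
  apply: submx_trans (addsmxSl _ _).
  rewrite /im_phi -mulmxA mulmxE -exprD subn0.
  have -> : (p - a - 1 + a = p - 1)%N by move: ap p_gt1; clear; lia.
  have -> : k + a%:Z + (p - a - 1)%:Z = k + (p - 1)%:Z.
    by move: ap p_gt1; clear; lia.
  exact: submx_refl.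
apply/rV_subP => _ /submxP[y ->]; rewrite mulmxA.
by have /ker_phiP[_ ->] := submxMl y (ker (k + a%:Z) a); rewrite sub0mx.
Qed.

Lemma slash0_den k : (sq_den (slash k 0) :=: im (k + (p - 1)%:Z) (p - 1))%MS.
Proof. by rewrite /= ker_phi0 subn0; apply: addsmx0. Qed.

(** Surjectivity is lifting along the string by a <= n - 2k steps. Injectivity is the division by
    phi^a used in [slash_num_sub_den]. *)
Lemma slash_iso k a : in_range k -> a%:Z <= n%:Z - 2 * k ->
  mod_iso_map (sq_map (phi ^+ a) (slash (k + a%:Z) a) (slash k 0)).
Proof.
move=> kR ha; have ap : (a <= p - 2)%N.
  by case/and3P: kR => _ _; move: ha; clear; lia.
have cf := slash_compatX k ap; apply: sq_map_iso cf _ _ _ => [|v|v].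
- exact: slash_den_sub.
- case/ker_phiP=> vU v0; rewrite slash0_den => /im_phiP[w wU e].
  set x := w *m phi ^+ (p - a - 1).
  have eK : k + a%:Z + (p - a - 1)%:Z = k + (p - 1)%:Z.
    by move: ap p_gt1; clear; lia.
  rewrite -[v](subrK x) addrC; apply: addmx_sub_adds.
    by apply/im_phiP; exists w; rewrite ?eK.
  apply/ker_phiP; split.
    rewrite addmx_sub ?eqmx_opp //.
    by have := omega_phi_exp (p - a - 1) wU; rewrite -eK addrK.
  rewrite mulmxBl e phiXD; apply/eqP; rewrite subr_eq0; apply/eqP.
  by congr (_ *m _ ^+ _); move: ap p_gt1; clear; lia.
case/ker_phiP; rewrite expr1 => vU v0.
have [|w wU e] := ker_lift charF (r := a) vU v0.
  by case/and3P: kR => _ _; move: ha; clear; lia.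
exists w; last by rewrite -e subrr sub0mx.
by apply/ker_phiP; rewrite -phiXS -e.
Qed.

(** Second isomorphism theorem: S and Im phi^(p-1) together span Ker phi, and they meet in rad S. *)
Lemma specht_iso (k : nat) : in_range k%:Z ->
  mod_iso_map (sq_map 1%:M (D k) (slash k%:Z 0)).
Proof.
move=> kR; have k_le : (2 * k <= n)%N by case/and3P: kR => _ _; clear; lia.
have rad v := specht_radical charF kR v (specht_module F n k).
apply: sq_map_iso => [||v hv|v hv].
- split; rewrite ?mulmx1; first by apply/centgmxP => x _; rewrite mul1mx mulmx1.
    exact: specht_sub_ker.
  by apply/rV_subP => v /rad[_]; rewrite slash0_den.
- exact: radical_sub.
- by rewrite mulmx1 slash0_den => h; apply/rad.
have /sub_addsmxP[[x y] /= ->] := submx_trans hv (ker_sub_specht_im charF kR).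
exists (x *m S k); first exact: submxMl.
by rewrite mulmx1 addrC addKr slash0_den submxMl.
Qed.

(** If w phi^(p-1) = 0, then [ker_split] gives w = u + y phi with u phi^a = 0, so w phi^a = y
    phi^(a+1). *)
Lemma backslash_num_sub_den K a : (a <= p - 2)%N ->
  ~~ in_range (n%:Z - K) || (2 * K - n%:Z < a%:Z) ->
  (sq_num (backslash (K - a%:Z) a) <= sq_den (backslash (K - a%:Z) a))%MS.
Proof.
move=> ap hK; apply/rV_subP => v; rewrite sub_capmx subrK.
case/andP=> /im_phiP[w wU ->] /ker_phiP[_]; rewrite phiXD => w0.
have [||u [y [uU u0 yU ->]]] := ker_split charF n_gt0 (s := a) _ _ wU w0.
- by move: ap p_gt1; clear; lia.
- by move=> c hc; case/orP: hK => [/negPf->//|]; move: hc; clear; lia.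
rewrite mulmxDl u0 add0r -mulmxA mulmxE -exprS /= subrK.
by apply/im_phiP; exists y.
Qed.

Section Range.

Variables (k : nat) (k_range : in_range k%:Z).

Let m : nat := (n - 2 * k)%N.

Let mE : n%:Z - 2 * k%:Z = m%:Z.
Proof. by case/and3P: k_range => _ _; rewrite /m; clear; lia. Qed.

Let mp : (m <= p - 2)%N.
Proof. by case/and3P: k_range => _ _; rewrite mE; clear; lia. Qed.

(** Lifting puts Ker phi inside Im phi^m, and [ker_im_long] with r = m + 1 gives injectivity. For
    surjectivity, [ker_split] starts at s = m + 1, just above its exceptional exponent m. *)
Lemma slash_backslash_iso :
  mod_iso_map (sq_map 1%:M (slash k%:Z 0) (backslash k%:Z m)).
Proof.
have hlift v : (v <= ker k%:Z 1)%MS -> (v <= im (k%:Z + m%:Z) m)%MS.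
  case/ker_phiP; rewrite expr1 => vU v0; apply/im_phiP.
  by apply: (ker_lift charF) => //; rewrite mE lexx; move: mp p_gt1; clear; lia.
apply: sq_map_iso => [||v hv|v].
- split; rewrite ?mulmx1; first by apply/centgmxP => x _; rewrite mul1mx mulmx1.
    apply/rV_subP => v hv; rewrite sub_capmx hlift //=.
    case/ker_phiP: hv => vU v0; apply/ker_phiP; split=> //.
    by apply: phiX_leq v0 _; move: mp p_gt1; clear; lia.
  rewrite slash0_den; apply/rV_subP => v /im_phiP[w wU ->]; apply/im_phiP.
  exists (w *m phi ^+ (p - 1 - m.+1)).
    have := omega_phi_exp (p - 1 - m.+1) wU.
    have -> // : k%:Z + (p - 1)%:Z - (p - 1 - m.+1)%:Z = k%:Z + m%:Z + 1.
    by move: mp p_gt1; clear; lia.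
  by rewrite phiXD subnK //; move: mp p_gt1; clear; lia.
- exact: slash_den_sub.
- rewrite mulmx1 slash0_den => /im_phiP[w wU e]; apply/im_phiP.
  case/ker_phiP: hv; rewrite expr1 => vU v0; rewrite e.
  apply: (ker_im_long charF n_gt0); last by rewrite mE; clear; lia.
    by move: wU; have -> // : k%:Z + m%:Z + 1 = k%:Z + m.+1%:Z by clear; lia.
  by rewrite -phiXS -e.
rewrite sub_capmx => /andP[/im_phiP[w wU e] /ker_phiP[vU v0]].
have w0 : w *m phi ^+ (p - 1) = 0.
  by move: v0; rewrite e phiXD => <-; congr (_ *m _ ^+ _); move: mp p_gt1; clear; lia.
have [||u [y [uU u0 yU e']]] := ker_split charF n_gt0 (s := m.+1) _ _ wU w0.
- by move: p_gt1; clear; lia.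
- by move=> c hc; rewrite negb_and; apply/orP; right; move: hc mE; clear; lia.
exists (u *m phi ^+ m).
  apply/ker_phiP; rewrite expr1 phiXS; split=> //.
  by have := omega_phi_exp m uU; rewrite addrK.
rewrite mulmx1 e e' mulmxDl addrC addKr -mulmxA mulmxE -exprS.
by apply/im_phiP; exists y.
Qed.

Lemma backslash_compatX a : (a <= m)%N ->
  sq_compat (phi ^+ a) (backslash (k%:Z + a%:Z) (m - a)) (backslash k%:Z m).
Proof.
move=> am; have eK : k%:Z + a%:Z + (m - a)%:Z = k%:Z + m%:Z by move: am; clear; lia.
split; first exact: phiX_centgmx.
  apply/rV_subP => _ /submxP[y ->]; rewrite mulmxA.
  have := submxMl y (sq_num (backslash (k%:Z + a%:Z) (m - a))).
  move: (y *m _) => v; rewrite sub_capmx eK.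
  case/andP=> /im_phiP[w wU ->] /ker_phiP[vU v0]; rewrite sub_capmx; apply/andP; split.
    by apply/im_phiP; exists w; rewrite // phiXD subnK.
  apply/ker_phiP; split.
    by have := omega_phi_exp a vU; rewrite addrK.
  rewrite -[RHS]v0 !phiXD; congr (_ *m _ ^+ _); move: am mp; clear; lia.
rewrite /= eK /im_phi -mulmxA mulmxE -exprD addSn subnK //; exact: submx_refl.
Qed.

(** For injectivity, [ker_split] runs over exponents below m, so the exceptional one is not met; s =
    0 forces u = 0. *)
Lemma backslash_iso a : (a <= m)%N ->
  mod_iso_map (sq_map (phi ^+ a) (backslash (k%:Z + a%:Z) (m - a)) (backslash k%:Z m)).
Proof.
move=> am; have eK : k%:Z + a%:Z + (m - a)%:Z = k%:Z + m%:Z by move: am; clear; lia.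
have shift w : w *m phi ^+ (m - a) *m phi ^+ a = w *m phi ^+ m.
  by rewrite phiXD subnK.
apply: sq_map_iso => [||v|v].
- exact: backslash_compatX.
- by apply: backslash_den_sub => //; move: mp; clear; lia.
- rewrite sub_capmx eK => /andP[/im_phiP[w wU ->] /ker_phiP[_ v0]].
  rewrite shift => /im_phiP[y yU e].
  have z0 : (w - y *m phi) *m phi ^+ m = 0.
    by rewrite mulmxBl e exprS -mulmxE mulmxA subrr.
  have zU : (w - y *m phi <= omega (k%:Z + m%:Z))%MS.
    by rewrite addmx_sub ?eqmx_opp //; have := omega_phi_exp 1 yU; rewrite expr1 addrK.
  have [||u [y' [uU]]] := ker_split charF n_gt0 (s := 0) _ _ zU z0.
  - by move: mp p_gt1; clear; lia.
  - by move=> c hc; rewrite negb_and; apply/orP; right; move: hc mE; clear; lia.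
  rewrite expr0 mulmx1 => -> y'U /eqP; rewrite add0r subr_eq -mulmxDl => /eqP->.
  rewrite -mulmxA mulmxE -exprS /= eK; apply/im_phiP.
  by exists (y' + y); rewrite ?addmx_sub.
rewrite sub_capmx => /andP[/im_phiP[w wU ->] /ker_phiP[vU v0]].
exists (w *m phi ^+ (m - a)); last by rewrite shift subrr sub0mx.
rewrite sub_capmx; apply/andP; split; first by apply/im_phiP; exists w; rewrite ?eK.
apply/ker_phiP; split.
  have := omega_phi_exp (m - a) wU.
  by have -> : k%:Z + m%:Z - (m - a)%:Z = k%:Z + a%:Z by move: am; clear; lia.
rewrite phiXD -[RHS]v0 phiXD; congr (_ *m _ ^+ _); move: am mp; clear; lia.
Qed.

End Range.
End Homology.

(** An arrow f compatible with the descents g and h to a common bottom term is compatible with their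
    inverses. *)
Lemma pinvmx_factor (F : fieldType) a b c d (e : 'M[F]_(a, b)) (g : 'M_(c, b))
    (h : 'M_(d, b)) (f : 'M_(c, d)) :
  f *m h = g -> row_full g -> row_free h -> e *m pinvmx h = e *m pinvmx g *m f.
Proof.
move=> fg g_full h_free; rewrite -mulmxA; congr (_ *m _).
by rewrite -[LHS]mul1mx -(mulVpmx g_full) -fg -!mulmxA mulmxVp // mulmx1.
Qed.

(** * Assembling the strings *)

Section Rows.

Variables (p : nat) (F : fieldType) (n : nat).
Hypotheses (charF : p \in [pchar F]) (n_gt0 : (0 < n)%N).
Local Notation phi := (phi_mx F n).
Local Notation in_range := (in_range p n).
Local Notation slash := (slash_sq F n p).
Local Notation backslash := (backslash_sq F n p).
Local Notation D := (D_sq F n).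
Implicit Types (K i : int) (k a : nat).

Let p_gt1 : (1 < p)%N := prime_gt1 (pcharf_prime charF).

Lemma in_rangeP k :
  reflect (p <> 2%N /\ 0 <= n%:Z - 2 * k%:Z <= p%:Z - 2) (in_range k%:Z).
Proof.
apply: (iffP and3P) => [[/eqP h1 _ h2]|[/eqP h1 h2]] //.
Qed.

Lemma slash0_nonvanishing k : in_range k%:Z -> mdim (sq_mod (slash k%:Z 0)) <> 0%N.
Proof.
move=> kR /sq_dim_eq0; rewrite slash0_den => h.
have k_le : (2 * k <= n)%N by case/and3P: kR => _ _; clear; lia.
have := specht_not_sub_im charF kR.
by rewrite (submx_trans (specht_sub_ker _ k_le) h).
Qed.

(** Indexed by the bottom degree of the string, an integer since a may exceed the degree of the
    term. *)
Lemma H_slash_nonvanishing K a : (a <= p - 2)%N ->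
  nonvanishing_mod (H_slash F n p (K + a%:Z) a) <->
  in_range K /\ a%:Z <= n%:Z - 2 * K.
Proof.
move=> ap; split=> [h|[KR ha]].
  apply/andP; apply: contraNT h => h; apply/eqP/sq_dim_eq0.
  by apply: slash_num_sub_den => //; rewrite ltNge -negb_and.
case: K => k in KR ha *; last by case/and3P: KR.
by apply/eqP; rewrite (mod_iso_dim (slash_iso charF KR ha)); apply: slash0_nonvanishing.
Qed.

Lemma H_slash_isom k a : in_range k%:Z -> a%:Z <= n%:Z - 2 * k%:Z ->
  mod_isom (H_slash F n p (k%:Z + a%:Z) a) (D_mod F n k).
Proof.
move=> kR ha.
exact: mod_iso_isom (mod_iso_comp (slash_iso charF kR ha) (mod_iso_inv (specht_iso charF kR))).
Qed.

Lemma backslash_nonvanishing k a : in_range k%:Z -> (a <= n - 2 * k)%N ->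
  mdim (sq_mod (backslash (k%:Z + a%:Z) (n - 2 * k - a))) <> 0%N.
Proof.
move=> kR ha; rewrite (mod_iso_dim (backslash_iso charF n_gt0 kR ha)).
rewrite -(mod_iso_dim (slash_backslash_iso charF n_gt0 kR)).
exact: slash0_nonvanishing.
Qed.

Lemma H_backslash_nonvanishing K a : (a <= p - 2)%N ->
  nonvanishing_mod (H_backslash F n p (K - a%:Z) a) <->
  in_range (n%:Z - K) /\ a%:Z <= 2 * K - n%:Z.
Proof.
move=> ap; split=> [h|[KR ha]].
  apply/andP; apply: contraNT h => h; apply/eqP/sq_dim_eq0.
  by apply: backslash_num_sub_den => //; rewrite ltNge -negb_and.
have [k kE] : exists k : nat, n%:Z - K = k%:Z.
  by case/and3P: KR => _; case: (n%:Z - K) => k //; exists k.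
rewrite kE in KR; have := @backslash_nonvanishing k (n - 2 * k - a) KR.
have -> : (n - 2 * k - (n - 2 * k - a) = a)%N by move: kE ha; clear; lia.
have -> : k%:Z + (n - 2 * k - a)%:Z = K - a%:Z by move: kE ha; clear; lia.
by move=> h; apply/eqP/h; rewrite leq_subr.
Qed.

Lemma H_backslash_isom k a : in_range k%:Z -> (a <= n - 2 * k)%N ->
  mod_isom (H_backslash F n p (k%:Z + a%:Z) (n - 2 * k - a)) (D_mod F n k).
Proof.
move=> kR ha; apply: mod_iso_isom; apply: mod_iso_comp (backslash_iso charF n_gt0 kR ha) _.
apply: mod_iso_comp (mod_iso_inv (slash_backslash_iso charF n_gt0 kR)) _.
exact: mod_iso_inv (specht_iso charF kR).
Qed.

Lemma slash_homology_nonvanishing k :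
  nonvanishing (slash_homology F n p k%:Z) <-> in_range k%:Z.
Proof.
rewrite string_nonvanishing; split=> [[i hi]|kR].
  have [a ea] : exists a : nat, i = k%:Z + a%:Z.
    by exists `|(i - k%:Z)%R|%N; move: hi; clear; lia.
  rewrite ea in hi *; have -> : `|(k%:Z + a%:Z - k%:Z)%R|%N = a by clear; lia.
  apply: contraNT => h; apply: slash_num_sub_den; rewrite ?h //.
  by move: hi; clear; lia.
exists k%:Z; first by move: p_gt1; clear; lia.
by rewrite subrr; apply/negP => /sq_dim_eq0; apply: slash0_nonvanishing.
Qed.

Lemma backslash_homology_nonvanishing k :
  nonvanishing (backslash_homology F n p (n%:Z - k%:Z)) <-> in_range k%:Z.
Proof.
rewrite string_nonvanishing; split=> [[i hi]|kR].
  have [a ea] : exists a : nat, i = n%:Z - k%:Z - a%:Z.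
    by exists `|(n%:Z - k%:Z - i)%R|%N; move: hi; clear; lia.
  rewrite ea in hi *.
  have -> : `|(n%:Z - k%:Z - (n%:Z - k%:Z - a%:Z))%R|%N = a by clear; lia.
  apply: contraNT => h; apply: (backslash_num_sub_den charF n_gt0).
    by move: hi; clear; lia.
  by rewrite opprB addrCA subrr addr0 h.
exists (n%:Z - k%:Z); first by move: p_gt1; clear; lia.
rewrite subrr; apply/negP => /sq_dim_eq0.
have := @backslash_nonvanishing k (n - 2 * k) kR (leqnn _).
rewrite subnn; have -> // : k%:Z + (n - 2 * k)%:Z = n%:Z - k%:Z.
by case/and3P: kR => _ _; clear; lia.
Qed.

Section Range.

Variables (k : nat) (k_range : in_range k%:Z).
Local Notation top := (n%:Z - k%:Z).

Let k_bounds : 0 <= n%:Z - 2 * k%:Z <= p%:Z - 2.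
Proof. by case/and3P: k_range. Qed.

Let sl i := slash i `|(i - k%:Z)%R|%N.
Let bs i := backslash i `|(top - i)%R|%N.
(** Every term is compared with the one in degree k by a power of [phi]. These descents commute with
    the arrows as exponents add up, so the arrows are isomorphisms by cancellation. *)
Let down_sl i := sq_map (phi ^+ `|(i - k%:Z)%R|%N) (sl i) (slash k%:Z 0).
Let down_bs i := sq_map (phi ^+ `|(i - k%:Z)%R|%N) (bs i) (backslash k%:Z (n - 2 * k)).

Lemma offset i : k%:Z <= i <= top ->
  exists2 a, (a <= n - 2 * k)%N & i = k%:Z + a%:Z.
Proof.
by move=> hi; exists `|(i - k%:Z)%R|%N; move: hi k_bounds; clear; lia.
Qed.

Lemma slE a : sl (k%:Z + a%:Z) = slash (k%:Z + a%:Z) a.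
Proof. by rewrite /sl; congr (slash _ _); clear; lia. Qed.

Lemma bsE a : (a <= n - 2 * k)%N ->
  bs (k%:Z + a%:Z) = backslash (k%:Z + a%:Z) (n - 2 * k - a).
Proof.
move=> ha; rewrite /bs; congr (backslash _ _); move: ha k_bounds; clear; lia.
Qed.

Lemma down_sl_iso i : k%:Z <= i <= top -> mod_iso_map (down_sl i).
Proof.
case/offset=> a ha ->; rewrite /down_sl slE.
have -> : `|(k%:Z + a%:Z - k%:Z)%R|%N = a by clear; lia.
by apply: (slash_iso charF) => //; move: ha k_bounds; clear; lia.
Qed.

Lemma down_bs_iso i : k%:Z <= i <= top -> mod_iso_map (down_bs i).
Proof.
case/offset=> a ha ->; rewrite /down_bs bsE //.
have -> : `|(k%:Z + a%:Z - k%:Z)%R|%N = a by clear; lia.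
exact: (backslash_iso charF).
Qed.

Lemma down_sl_step i : k%:Z < i <= top ->
  sq_map phi (sl i) (sl (i - 1)) *m down_sl (i - 1) = down_sl i.
Proof.
move=> hi; have [|a ha ea] := @offset (i - 1); first by move: hi; clear; lia.
have ei : i = k%:Z + a.+1%:Z by move: ea; clear; lia.
rewrite /down_sl sq_map_comp.
- rewrite mulmxE -exprS.
  by have -> : `|(i - 1 - k%:Z)%R|.+1 = `|(i - k%:Z)%R|%N by rewrite ea ei; clear; lia.
- by apply: slash_string_compat hi.
rewrite ea slE; have -> : `|(k%:Z + a%:Z - k%:Z)%R|%N = a by clear; lia.
by apply: (slash_compatX n charF); move: ha k_bounds; clear; lia.
Qed.

Lemma down_bs_step i : k%:Z < i <= top ->
  sq_map phi (bs i) (bs (i - 1)) *m down_bs (i - 1) = down_bs i.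
Proof.
move=> hi; have [|a ha ea] := @offset (i - 1); first by move: hi; clear; lia.
have ei : i = k%:Z + a.+1%:Z by move: ea; clear; lia.
rewrite /down_bs sq_map_comp.
- rewrite mulmxE -exprS.
  by have -> : `|(i - 1 - k%:Z)%R|.+1 = `|(i - k%:Z)%R|%N by rewrite ea ei; clear; lia.
- by apply: backslash_string_compat hi.
rewrite ea bsE //; have -> : `|(k%:Z + a%:Z - k%:Z)%R|%N = a by clear; lia.
exact: backslash_compatX.
Qed.

Lemma in_below i : k%:Z < i <= top -> k%:Z <= i - 1 <= top /\ k%:Z <= i <= top.
Proof. by clear; lia. Qed.

Lemma slash_arrows_iso : arrows_iso k%:Z top (slash_row F n p k%:Z top).
Proof.
apply: string_arrows_iso => i hi; have [h1 h2] := in_below hi.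
apply: (mod_iso_cancelr (down_sl_iso h1)).
by rewrite down_sl_step //; apply: down_sl_iso.
Qed.

Lemma backslash_arrows_iso : arrows_iso k%:Z top (backslash_row F n p top k%:Z).
Proof.
apply: string_arrows_iso => i hi; have [h1 h2] := in_below hi.
apply: (mod_iso_cancelr (down_bs_iso h1)).
by rewrite down_bs_step //; apply: down_bs_iso.
Qed.

Lemma D_arrows_iso : arrows_iso k%:Z top (D_row F n k k%:Z top).
Proof.
by apply: string_arrows_iso => i hi; rewrite sq_map1; apply: mod_iso1.
Qed.

Let specht_sl := sq_map 1%:M (D k) (slash k%:Z 0).
Let specht_bs := specht_sl *m sq_map 1%:M (slash k%:Z 0) (backslash k%:Z (n - 2 * k)).

Lemma slash_row_isom_D :
  gcomplex_isom (slash_row F n p k%:Z top) (D_row F n k k%:Z top).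
Proof.
have si : mod_iso_map specht_sl := specht_iso charF k_range.
apply: (@string_isom _ _ _ _ _ _ _ _ _ sl (fun=> D k) phi 1%:M
  (fun i => down_sl i *m pinvmx specht_sl)) => i hi hi'.
- exact: mod_iso_comp (down_sl_iso hi) (mod_iso_inv si).
- by rewrite sq_map1 mulmx1 mulmxA down_sl_step.
- by rewrite hi in hi'.
by rewrite hi in hi'.
Qed.

Lemma D_isom_backslash_row :
  gcomplex_isom (D_row F n k k%:Z top) (backslash_row F n p top k%:Z).
Proof.
have si : mod_iso_map specht_bs.
  exact: mod_iso_comp (specht_iso charF k_range) (slash_backslash_iso charF n_gt0 k_range).
apply: (@string_isom _ _ _ _ _ _ _ _ _ (fun=> D k) bs 1%:M phi
  (fun i => specht_bs *m pinvmx (down_bs i))) => i hi hi'.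
- exact: mod_iso_comp si (mod_iso_inv (down_bs_iso hi)).
- have [h1 h2] := in_below hi; rewrite sq_map1 mul1mx.
  have [_ _ full_i] := down_bs_iso h2; have [_ free_j _] := down_bs_iso h1.
  exact: pinvmx_factor (down_bs_step hi) full_i free_j.
- by rewrite hi in hi'.
by rewrite hi in hi'.
Qed.

Lemma slash_homology_isom_row :
  gcomplex_isom (slash_homology F n p k%:Z) (slash_row F n p k%:Z top).
Proof.
apply: (@string_isom _ _ _ _ _ _ _ _ _ sl sl phi phi (fun i => 1%:M)) => i hi hi'.
- exact: mod_iso1.
- exact: etrans (mulmx1 _) (esym (mul1mx _)).
- apply/sq_dim_eq0; have [a ea] : exists a : nat, i = k%:Z + a%:Z.
    by exists `|(i - k%:Z)%R|%N; move: hi; clear; lia.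
  rewrite ea slE; apply: (slash_num_sub_den charF n_gt0).
    by move: ea hi k_bounds; clear; lia.
  by apply/orP; right; move: ea hi' hi; clear; lia.
by move: hi hi' k_bounds p_gt1; clear; lia.
Qed.

Lemma backslash_row_isom_homology :
  gcomplex_isom (backslash_row F n p top k%:Z) (backslash_homology F n p top).
Proof.
apply: (@string_isom _ _ _ _ _ _ _ _ _ bs bs phi phi (fun i => 1%:M)) => i hi hi'.
- exact: mod_iso1.
- exact: etrans (mulmx1 _) (esym (mul1mx _)).
- by move: hi hi' k_bounds p_gt1; clear; lia.
apply/sq_dim_eq0; have [a ea] : exists a : nat, i = top - a%:Z.
  by exists `|(top - i)%R|%N; move: hi; clear; lia.
have -> : bs i = backslash (top - a%:Z) a.
  by rewrite ea /bs; congr (backslash _ _); clear; lia.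
apply: (backslash_num_sub_den charF n_gt0).
  by move: ea hi k_bounds; clear; lia.
by apply/orP; right; move: ea hi' hi; clear; lia.
Qed.

End Range.
End Rows.

Theorem theorem3p7 (p : nat) (F : fieldType) (n : nat)
    (p_prime : prime p) (charF : p \in [pchar F]) (n_gt0 : (0 < n)%N) :
  (forall k : nat, (k <= n)%N ->
    [/\ nonvanishing (slash_homology F n p k%:Z) <->
          p <> 2%N /\ 0 <= n%:Z - 2 * k%:Z <= p%:Z - 2,
        nonvanishing (backslash_homology F n p (n%:Z - k%:Z)) <->
          p <> 2%N /\ 0 <= n%:Z - 2 * k%:Z <= p%:Z - 2
      & p <> 2%N -> 0 <= n%:Z - 2 * k%:Z <= p%:Z - 2 ->
        [/\ gcomplex_isom (slash_homology F n p k%:Z)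
                          (slash_row F n p k%:Z (n%:Z - k%:Z)),
            gcomplex_isom (slash_row F n p k%:Z (n%:Z - k%:Z))
                          (D_row F n k k%:Z (n%:Z - k%:Z)),
            gcomplex_isom (D_row F n k k%:Z (n%:Z - k%:Z))
                          (backslash_row F n p (n%:Z - k%:Z) k%:Z),
            gcomplex_isom (backslash_row F n p (n%:Z - k%:Z) k%:Z)
                          (backslash_homology F n p (n%:Z - k%:Z))
          & [/\ arrows_iso k%:Z (n%:Z - k%:Z)
                  (slash_row F n p k%:Z (n%:Z - k%:Z)),
                arrows_iso k%:Z (n%:Z - k%:Z)
                  (D_row F n k k%:Z (n%:Z - k%:Z))
              & arrows_iso k%:Z (n%:Z - k%:Z)
                  (backslash_row F n p (n%:Z - k%:Z) k%:Z)]]]) /\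
  (forall k a : nat, (k <= n)%N -> (a <= p - 2)%N ->
    (nonvanishing_mod (H_slash F n p k%:Z a) <->
       [/\ p <> 2%N, (a <= k)%N
         & a%:Z <= n%:Z - 2 * (k%:Z - a%:Z) <= p%:Z - 2]) /\
    (nonvanishing_mod (H_slash F n p k%:Z a) ->
       mod_isom (H_slash F n p k%:Z a) (D_mod F n (k - a)))) /\
  (forall k a : nat, (k <= n)%N -> (a <= p - 2)%N ->
    (nonvanishing_mod (H_backslash F n p k%:Z a) <->
       [/\ p <> 2%N, (k + a <= n)%N
         & a%:Z <= 2 * (k%:Z + a%:Z) - n%:Z <= p%:Z - 2]) /\
    (nonvanishing_mod (H_backslash F n p k%:Z a) ->
       mod_isom (H_backslash F n p k%:Z a) (D_mod F n (n - (k + a))))).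
Proof.
split; last split.
- move=> k _; split.
  + by rewrite slash_homology_nonvanishing //; split=> /in_rangeP.
  + by rewrite backslash_homology_nonvanishing //; split=> /in_rangeP.
  move=> p2 hk; have kR : in_range p n k%:Z by apply/in_rangeP.
  split; last split.
  + exact: slash_homology_isom_row.
  + exact: slash_row_isom_D.
  + exact: D_isom_backslash_row.
  + exact: backslash_row_isom_homology.
  + exact: slash_arrows_iso.
  + exact: D_arrows_iso.
  exact: backslash_arrows_iso.
(* The string through this term ends in degree k - a. *)
- move=> k a _ ap; have hH := H_slash_nonvanishing charF n_gt0 (k%:Z - a%:Z) ap.
  rewrite subrK in hH; split=> [|/hH[kR ha]].
    split=> [/hH[kR ha]|[p2 ak hk]].
      case/and3P: (kR) => /eqP p2 k0 hk; split=> //.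
        by move: k0; clear; lia.
      by move: ha hk; clear; lia.
    apply/hH; split; last by move: hk; clear; lia.
    by apply/and3P; split; [exact/eqP | move: ak | move: ak hk]; clear; lia.
  have ka : k%:Z - a%:Z = (k - a)%:Z by case/and3P: kR => _ h _; move: h; clear; lia.
  have kE : k%:Z = (k - a)%:Z + a%:Z by rewrite -ka subrK.
  by rewrite ka in kR ha; rewrite {1}kE; apply: H_slash_isom.
(* The string through this term starts in degree k + a and so ends in degree n - (k + a). *)
move=> k a _ ap; have hH := H_backslash_nonvanishing charF n_gt0 (k%:Z + a%:Z) ap.
rewrite addrK in hH; split=> [|/hH[kR ha]].
  split=> [/hH[kR ha]|[p2 ak hk]].
    case/and3P: (kR) => /eqP p2 k0 hk; split=> //.
      by move: k0; clear; lia.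
    by move: ha hk; clear; lia.
  apply/hH; split; last by move: hk; clear; lia.
  by apply/and3P; split; [exact/eqP | move: ak | move: ak hk]; clear; lia.
have ka : n%:Z - (k%:Z + a%:Z) = (n - (k + a))%:Z.
  by case/and3P: kR => _ h _; move: h; clear; lia.
rewrite ka in kR; set j := (n - (k + a))%N in ka kR *.
have := @H_backslash_isom p F n charF n_gt0 j (n - 2 * j - a) kR (leq_subr _ _).
have -> : (n - 2 * j - (n - 2 * j - a) = a)%N by move: ka ha; clear; lia.
by have -> : j%:Z + (n - 2 * j - a)%:Z = k%:Z by move: ka ha; clear; lia.
Qed.
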